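(* Let $(A_n)_{n\in\mathbb N}$ be a sequence of symmetric random matrices satisfying assumptions (i)--(iii) of the context, with associated means $\mu_n$ and variances $\sigma_n^2$. Let $$v_n:=\mathop{\mathrm{arg\,max}}_{x\in\mathbb R^n:\|x\|_r\le1}\|A_nx\|_p$$ (a maximizer with nonnegative entries), and let $\mathbf 1$ denote the $n$-dimensional vector of all ones. Then the following hold. (a) For $1<p<r<\infty$, $$\|v_n-n^{-1/r}\mathbf 1\|_\infty\le\frac{6p}{r-p}\,n^{-\frac1r}\sqrt{\frac{\log n}{n\mu_n}\times\frac{\sigma_n^2}{\mu_n}},\qquad \mathbb P_0\text{-eventually almost surely}.$$ (b) For $p=r\in(1,\infty)$, $$\|v_n-n^{-1/r}\mathbf 1\|_\infty\le\frac{60r}{r-1}\,n^{-\frac1r}\sqrt{\frac{\log n}{n\mu_n}\times\frac{\sigma_n^2}{\mu_n}},\qquad \mathbb P_0\text{-eventually almost surely}.$$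
   Context: $\|x\|_q=(\sum_i|x_i|^q)^{1/q}$ and $\|x\|_\infty=\max_i|x_i|$. $f(n)=\omega(g(n))$ means $f(n)/g(n)\to\infty$. Assumptions on the matrices. For each $n\ge1$, $F_n$ is a distribution supported on $[0,\infty)$ with finite mean $\mu_n$ and variance $\sigma_n^2$, and $A_n=(a^n_{ij})_{i,j=1}^n$ is a symmetric random matrix such that: (i) $(a^n_{ij})_{1\le i<j\le n}$ are i.i.d. with common distribution $F_n$, and $a^n_{ii}=0$ for all $i\in[n]=\{1,\dots,n\}$; (ii) $\mu_n=O(1)$, $\mu_n=\omega\big(\frac{\log^{2/3}n}{n^{1/3}}\big)$, $\sigma_n\ge n^{-\frac12+c_0}$ for some constant $c_0>0$, and $\frac{\sigma_n^2}{\mu_n}=O(1)$; (iii) there exists $c<\infty$ (independent of $n$) such that $\mathbb E\big[|a^n_{12}-\mu_n|^k\big]\le\frac{k!}{2}c^{k-2}\sigma_n^2$ for all $k\ge3$. $\mathbb P_0$ is any probability measure on $\prod_n\mathbb R^{n\times n}$ whose projection on $\mathbb R^{n\times n}$ has the same law as $A_n$, for every $n$. A sequence of events $(E_n)_{n\ge1}$, with $E_n$ involving $A_n$, occurs $\mathbb P_0$-eventually almost surely if, $\mathbb P_0$-almost surely, $E_n$ occurs for all large enough $n$. *)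

(* Defs.v *)
From HB Require Import structures.
From mathcomp Require Import all_boot all_order all_algebra.
From mathcomp Require Import all_classical all_reals all_analysis.

Set Implicit Arguments.
Unset Strict Implicit.
Unset Printing Implicit Defensive.

Import Order.TTheory GRing.Theory Num.Theory.
Import numFieldNormedType.Exports.

Local Open Scope classical_set_scope.
Local Open Scope ring_scope.

(* Cylinders over one entry: they generate the Borel sigma-algebra of
   R^(n x n). *)
Definition entry_cylinders (R : realType) (n : nat) : set (set 'M[R]_n) :=
  [set S | exists (i j : 'I_n) (B : set R),
     measurable B /\ S = [set M : 'M[R]_n | B (M i j)]].

Definition rmatrix (R : realType) (n : nat) :=
  g_sigma_algebraType (@entry_cylinders R n).

(* Cylinders over one entry of one matrix: they generate the product
   sigma-algebra of \prod_n R^(n x n); the factor n = 0 is a single point. *)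
Definition seq_cylinders (R : realType) : set (set (forall n, 'M[R]_n)) :=
  [set S | exists (n : nat) (i j : 'I_n) (B : set R),
     measurable B /\ S = [set w : forall m, 'M[R]_m | B (w n i j)]].

Definition rmatrix_seq (R : realType) :=
  g_sigma_algebraType (@seq_cylinders R).

Definition has_law d d' (T : measurableType d) (T' : measurableType d')
    (R : realType) (P : probability T R) (X : T -> T')
    (F : probability T' R) : Prop :=
  forall B : set T', measurable B -> P (X @^-1` B) = F B.

Definition mutually_independent d (T : measurableType d) (R : realType)
    (P : probability T R) (I : finType) (X : I -> T -> R) : Prop :=
  forall (J : {set I}) (B : I -> set R),
    (forall i, measurable (B i)) ->
    (P (\bigcap_(i in [set` J]) X i @^-1` B i)
      = \prod_(i in J) P (X i @^-1` B i))%E.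

Section moments.
Context {R : realType}.
Implicit Type F : probability R R.

Definition dist_mean F : R := fine ('E_F[idfun])%E.

Definition dist_std F : R := Num.sqrt (fine ('V_F[idfun])%E).

Definition nonneg_dist F : Prop := F [set x : R | x < 0] = 0%E.

Definition finite_mean_var F : Prop :=
  F.-integrable setT (EFin : R -> \bar R) /\ ('V_F[idfun] < +oo)%E.

End moments.

Section matrix_assumptions.
Context {R : realType}.

Definition upper_pair (n : nat) := {ij : 'I_n * 'I_n | (ij.1 < ij.2)%N}.

Definition symmetric_iid_entries n d (T : measurableType d) (P : probability T R)
    (A : T -> 'M[R]_n) (F : probability R R) : Prop :=
  [/\ forall w, (A w)^T = A w,
      forall w i, A w i i = 0,
      forall i j : 'I_n, (i < j)%N -> has_law P (fun w => A w i j) F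
    & mutually_independent P
        (fun (ij : upper_pair n) w => A w (val ij).1 (val ij).2)].

Definition parameter_growth (mu sigma : nat -> R) : Prop :=
  [/\ mu =O_\oo (fun=> 1 : R),
      mu n / (ln n%:R `^ (2 / 3) / n%:R `^ 3^-1) @[n --> \oo] --> +oo,
      exists2 c0 : R, 0 < c0 &
        forall n : nat, (0 < n)%N -> n%:R `^ (- 2^-1 + c0) <= sigma n
    & (fun n => sigma n ^+ 2 / mu n) =O_\oo (fun=> 1 : R)].

(* This bounds the moments of a^n_12, the entry with 0-based indices (0, 1), which exists only
   when 1 < n. *)
Definition bernstein_moments (d : nat -> measure_display)
    (T : forall n, measurableType (d n)) (P : forall n, probability (T n) R)
    (A : forall n, T n -> 'M[R]_n) (mu sigma : nat -> R) : Prop :=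
  exists c : R, forall (n : nat) (i j : 'I_n) (k : nat),
    nat_of_ord i = 0%N -> nat_of_ord j = 1%N -> (3 <= k)%N ->
    ('E_(P n)[fun w => (`|A n w i j - mu n| ^+ k)%R]
      <= (k`!%:R / 2 * c ^+ (k - 2) * sigma n ^+ 2)%R%:E)%E.

End matrix_assumptions.

Section lnorms.
Context {R : realType}.

Definition lnorm (q : R) n (x : 'cV[R]_n) : R :=
  (\sum_i `|x i 0| `^ q) `^ q^-1.

Definition linf_norm n (x : 'cV[R]_n) : R := \big[Num.max/0]_i `|x i 0|.

(* The whole set of maximizers: the maximizer need not be unique for a fixed A. *)
Definition argmax_lnorm (r p : R) n (A : 'M[R]_n) : set 'cV[R]_n :=
  [set v | lnorm r v <= 1 /\
     forall x : 'cV[R]_n, lnorm r x <= 1 -> lnorm p (A *m x) <= lnorm p (A *m v)].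

Definition nonneg_vec n (v : 'cV[R]_n) : Prop := forall i, 0 <= v i 0.

End lnorms.

Definition eventually_as d (T : measurableType d) (R : realType)
    (P0 : probability T R) (E : nat -> set T) : Prop :=
  {ae P0, forall w, \forall n \near \oo, E n w}.

(* Main.v *)
Require Import Defs.
From HB Require Import structures.
From mathcomp Require Import all_boot all_order all_algebra.
From mathcomp Require Import all_classical all_reals all_analysis.
From mathcomp Require Import measurable_realfun ring lra.

Set Implicit Arguments.
Unset Strict Implicit.
Unset Printing Implicit Defensive.

Import Order.TTheory GRing.Theory Num.Theory.
Import numFieldNormedType.Exports.

Local Open Scope classical_set_scope.
Local Open Scope ring_scope.

(** Why the maximizer is nearly constant.

    Let [N = (n - 1) mu_n] and [B = A_n / N], so that [B] has the same
    maximizers as [A_n] and row sums close to 1. A nonnegative maximizer [v]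
    satisfies the stationarity equation
    [ |Bv|_p^p v_i^(r-1) = sum_j B_ij (Bv)_j^(p-1) ]  (argmax_stationary).
    If [B] averages so well that [(Bv)_j] is close to the mean of [v] for most
    indices [j], as weighted by any row of [B], then the right-hand side hardly
    depends on [i], except through the row sums. Hence so does the left-hand
    side, and [v] is nearly constant.

    This is made quantitative in two steps. The property used is row_mixing:
    [sum_j B_ij |(Bx)_j - mean x| <= delta |x|_oo] for every [i] and [x]. Applied
    to [v] itself with a small fixed [delta], it shows that the smallest and
    largest entries of [v] have ratio close to 1; in particular all entries are
    positive. Applied then to the deviation [v - min v], it gives an error
    [delta (max v - min v)], which is absorbed by the left-hand side, so that
    only the error [eps] of the row sums survives: up to a factor close to 1,
    [max v - min v <= 2 p / (r - 1) eps n^(-1/r)]  (fixed_point_flat, argmax_flat).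
    Nothing here distinguishes [p < r] from [p = r], and [p / (r - 1)] is at most
    [p / (r - p)] when [1 < p < r]; so one bound, with constant
    [6 p / (r - 1)], gives both parts of the theorem.

    For the random matrix, Bernstein's inequality gives
    [eps = 13/5 sigma_n sqrt(n log n) / N] for all rows at once. Mixing with a
    fixed [delta] needs much less than the concentration of the entries of
    [A_n^2]: it is enough that for every set [T] of at least [C / mu_n] indices
    and every choice of signs [s], the sum of [s_k (a_jk - mu_n)] over [j] in [T]
    and [k <> j] is at most [delta N |T|], and that no entry is much larger than
    [log n] (row_mixing_of_cut). Indeed the first condition says that for
    bounded [x] only [O(1 / mu_n)] indices [j] have [(Bx)_j] far from the mean,
    and by the second these carry a share [O(log n / (n mu_n^2))] of any row,
    which tends to 0 because [mu_n] is much larger than [(log n)^(2/3) / n^(1/3)].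
    There are [4^n] pairs of a set and a sign pattern, and each fails with
    probability at most [exp (- 4 (n - 1))].

    All these conditions bound linear forms in independent centred entries, so
    the single tail bound linear_form_tail covers them. The exceptional set has
    probability at most [4 / n^2], and the first Borel-Cantelli lemma, which does
    not involve the coupling of the different [n], concludes. *)

(** * Real powers *)

Section power_estimates.
Context {R : realType}.
Implicit Types a x y z : R.

Lemma powR_mean_value a x y : 0 < x -> x <= y ->
  exists2 xi, x <= xi <= y & y `^ a - x `^ a = a * xi `^ (a - 1) * (y - x).
Proof.
move=> x0 xy.
have dP z : z \in `]x, y[ -> is_derive z 1 (fun u : R => u `^ a) (a * z `^ (a - 1)).
  by rewrite in_itv/= => /andP[xz _]; have := lt_trans x0 xz; exact: is_derive1_powR.
have cP : {within `[x, y], continuous (fun u : R => u `^ a)}.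
  apply: derivable_within_continuous => z; rewrite in_itv/= => /andP[xz _].
  by apply: derivable_powR; rewrite in_itv/= andbT (lt_le_trans x0).
by have [c] := MVT_segment xy dP cP; rewrite in_itv/=; exists c.
Qed.

Lemma powR_above_tangent a x z : 1 < a -> 0 <= x -> 0 <= z ->
  x `^ a + a * x `^ (a - 1) * z <= (x + z) `^ a.
Proof.
move=> a1; have a0 := lt_trans ltr01 a1; rewrite le_eqVlt => /predU1P[<-|x0] z0.
  rewrite add0r !powR0 ?gt_eqF ?subr_gt0//.
  by rewrite mulr0 mul0r add0r powR_ge0.
have xz : x <= x + z by rewrite lerDl.
have [xi /andP[xxi _]] := powR_mean_value a x0 xz.
rewrite addrAC subrr add0r -lerBrDl => ->.
rewrite ler_wpM2r// ler_wpM2l ?(ltW a0)//.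
by rewrite ge0_ler_powR ?nnegrE ?subr_ge0 ?(ltW a1) ?(ltW x0)//; exact: le_trans (ltW x0) xxi.
Qed.

Lemma powR_sub_le a x y : 1 < a -> 0 <= x -> x <= y ->
  y `^ a - x `^ a <= a * y `^ (a - 1) * (y - x).
Proof.
move=> a1; have a0 := lt_trans ltr01 a1; rewrite le_eqVlt => /predU1P[<-|x0] xy.
  rewrite powR0 ?gt_eqF//.
  by rewrite !subr0 -mulrA [X in a * X]mulrC mulr_powRB1// ler_peMl ?powR_ge0// ltW.
have [xi /andP[xxi xiy] ->] := powR_mean_value a x0 xy.
rewrite ler_wpM2r ?subr_ge0// ler_wpM2l ?(ltW a0)//.
by rewrite ge0_ler_powR ?nnegrE ?subr_ge0 ?(ltW a1)// (le_trans (ltW x0))//.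
Qed.

Lemma powR1D_le a z : 0 < a -> a <= 1 -> 0 <= z -> (1 + z) `^ a <= 1 + a * z.
Proof.
move=> a0 a1 z0.
have z1 : 1 <= 1 + z by rewrite lerDl.
have [xi /andP[xi1 _]] := powR_mean_value a ltr01 z1.
rewrite powR1 => E; have -> : (1 + z) `^ a = 1 + a * xi `^ (a - 1) * z by lra.
rewrite lerD2l -mulrA ler_pM2l// ler_piMl//.
by rewrite -[leRHS](powRr0 xi) ler_powR// subr_le0.
Qed.

Lemma powR_root_le a b x y z : 0 < a -> 0 <= x -> 0 <= y -> 0 <= z ->
  x `^ a^-1 <= y * z `^ b^-1 -> x <= y `^ a * z `^ (a / b).
Proof.
move=> a0 x0 y0 z0 le1.
have := ge0_ler_powR (ltW a0) (powR_ge0 x a^-1) (mulr_ge0 y0 (powR_ge0 z b^-1)) le1.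
by rewrite -powRrM mulVf ?gt_eqF// powRr1// powRM ?powR_ge0// -powRrM [b^-1 * a]mulrC.
Qed.

Lemma one_powR a : 1 `^ a = 1 :> R.
Proof. by rewrite powR1. Qed.

Lemma powR_lipschitz a lo hi C x y : 0 < a -> 0 < lo ->
  (forall z, lo <= z <= hi -> z `^ (a - 1) <= C) ->
  lo <= x <= hi -> lo <= y <= hi -> `|x `^ a - y `^ a| <= a * C * `|x - y|.
Proof.
move=> a0 lo0 hC; wlog xy : x y / y <= x => [wl|].
  have [yx|/ltW xy] := leP y x; first exact: wl.
  by move=> hx hy; rewrite distrC (distrC x); exact: wl.
move=> /andP[lox xhi] /andP[loy yhi].
have y0 : 0 < y by exact: lt_le_trans loy.
have [z /andP[yz zx] ->] := powR_mean_value a y0 xy.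
rewrite !normrM (ger0_norm (ltW a0)) (ger0_norm (powR_ge0 _ _)).
rewrite ler_wpM2r// ler_wpM2l ?(ltW a0)// hC//.
by rewrite (le_trans loy)//= (le_trans zx).
Qed.

(** Uniform continuity on [[0, 2]] in a linear form that can be averaged against
    the rows of a matrix. Arguments are first raised to a small [t], below which
    the power is at most [k] and above which it is Lipschitz, so that exponents
    below and above 1 need no separate treatment. *)
Lemma powR_modulus a k : 0 < a -> 0 < k -> exists2 K : R, 0 < K &
  forall x y, 0 <= x <= 2 -> 0 <= y <= 2 -> `|x `^ a - y `^ a| <= k + K * `|x - y|.
Proof.
move=> a0 k0.
pose t := Num.min 1 (k `^ a^-1).
have t0 : 0 < t by rewrite lt_min ltr01 powR_gt0.
have t2 : t <= 2 by rewrite ge_min ler1n.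
have tk : t `^ a <= k.
  have -> : k = (k `^ a^-1) `^ a by rewrite -powRrM mulVf ?gt_eqF// powRr1// ltW.
  by rewrite ge0_ler_powR ?nnegrE ?powR_ge0 ?(ltW a0) ?(ltW t0)// ge_min lexx orbT.
pose C := t `^ (a - 1) + 2 `^ (a - 1).
have C0 : 0 < C by rewrite addr_gt0 ?powR_gt0.
have hC z : t <= z <= 2 -> z `^ (a - 1) <= C.
  move=> /andP[tz z2]; have z0 : 0 < z by exact: lt_le_trans tz.
  have [a1|a1] := leP 1 a.
    rewrite (@le_trans _ _ (2 `^ (a - 1)))// ?lerDr ?powR_ge0//.
    by rewrite ge0_ler_powR ?nnegrE ?subr_ge0 ?(ltW z0).
  rewrite (@le_trans _ _ (t `^ (a - 1)))// ?lerDl ?powR_ge0//.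
  rewrite -(opprB 1 a) !powRN lef_pV2 ?posrE ?powR_gt0//.
  by rewrite ge0_ler_powR ?nnegrE ?subr_ge0 ?(ltW a1) ?(ltW z0) ?(ltW t0).
exists (a * C); first exact: mulr_gt0.
have clip x : 0 <= x <= 2 -> [/\ t <= Num.max t x <= 2, x `^ a <= (Num.max t x) `^ a
    & (Num.max t x) `^ a <= x `^ a + k].
  move=> /andP[x0 x2]; split.
  - by rewrite le_max lexx ge_max t2.
  - by rewrite ge0_ler_powR ?nnegrE ?le_max ?x0 ?lexx ?orbT// ltW.
  - have [tx|xt] := leP t x; first by rewrite lerDl ltW.
    by rewrite (le_trans tk)// lerDr powR_ge0.
move=> x y hx hy.
have [rx x1 x2] := clip _ hx; have [ry y1 y2] := clip _ hy.
have := powR_lipschitz a0 t0 hC rx ry.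
have : `|Num.max t x - Num.max t y| <= `|x - y|.
  have := ler_norm (x - y); have := ler_norm (- (x - y)); rewrite normrN => A1 A2.
  clear -A1 A2; rewrite ler_norml; apply/andP.
  by split; case: (leP t x); case: (leP t y) => *; lra.
rewrite -(ler_pM2l (mulr_gt0 a0 C0)) => h1 h2; have := le_trans h2 h1.
move: (a * C * _) => S; rewrite !ler_norml => /andP[h3 h4].
by apply/andP; split; lra.
Qed.

Lemma powR_near1 a (tau : R) : 0 < tau -> exists2 w : R, 0 < w &
  forall z, 1 - w <= z <= 1 + w -> 1 - tau <= z `^ a <= 1 + tau.
Proof.
move=> tau0.
have cP : {for (1 : R), continuous (fun u : R => u `^ a)}.
  apply: differentiable_continuous; apply/derivable1_diffP.
  by apply: derivable_powR; rewrite in_itv/= andbT.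
have /cvgrPdist_le/(_ _ tau0) := cP.
rewrite powR1 => /nbhs_ballP[e /= e0 he].
exists (e / 2); first by rewrite divr_gt0.
move=> z /andP[z1 z2]; have := he z.
rewrite /ball/= ler_norml => h.
have /h/andP[] : `|1 - z| < e by rewrite ltr_norml; apply/andP; split; lra.
by move=> *; apply/andP; split; lra.
Qed.

End power_estimates.

(** * Norms and the stationarity equation of a maximizer *)

Section lnorm_facts.
Context {R : realType}.

Lemma lnorm_ge0 q m (x : 'cV[R]_m) : 0 <= lnorm q x.
Proof. exact: powR_ge0. Qed.

Lemma lnormE q m (x : 'cV[R]_m) : lnorm q x = (\sum_i `|x i 0| `^ q) `^ q^-1.
Proof. by []. Qed.

Lemma lnorm_powR q m (x : 'cV[R]_m) : q != 0 ->
  lnorm q x `^ q = \sum_i `|x i 0| `^ q.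
Proof.
move=> q0; rewrite /lnorm -powRrM mulVf// powRr1//.
by apply: sumr_ge0 => i _; exact: powR_ge0.
Qed.

Lemma lnormZ q m (a : R) (x : 'cV[R]_m) : 0 < q -> 0 <= a ->
  lnorm q (a *: x) = a * lnorm q x.
Proof.
move=> q0 a0; rewrite /lnorm.
under eq_bigr do rewrite mxE normrM powRM//.
rewrite -mulr_sumr powRM ?powR_ge0//; last by apply: sumr_ge0 => i _; exact: powR_ge0.
by rewrite -powRrM (ger0_norm a0) divff ?gt_eqF// powRr1.
Qed.

Lemma lnorm_eq0 q m (x : 'cV[R]_m) : q != 0 -> lnorm q x = 0 -> x = 0.
Proof.
move=> q0 /powR_eq0_eq0 /eqP; rewrite psumr_eq0; last by move=> i _; exact: powR_ge0.
move=> /allP h; apply/colP => i; rewrite mxE.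
have /eqP/powR_eq0_eq0/normr0_eq0 := h i (mem_index_enum _).
by [].
Qed.

Lemma lnorm0 q m : 0 < q -> lnorm q (0 : 'cV[R]_m) = 0.
Proof.
move=> q0; rewrite /lnorm big1 ?powR0 ?invr_eq0 ?gt_eqF// => i _.
by rewrite mxE normr0 powR0 ?gt_eqF.
Qed.

End lnorm_facts.

(* Unification must not compare two norms by unfolding their real powers. *)
#[local] Opaque lnorm.

Section stationarity.
Context {R : realType}.
Variables (p r : R) (n : nat) (B : 'M[R]_n) (v : 'cV[R]_n).
Hypotheses (p1 : 1 < p) (pr : p <= r).
Hypotheses (B0 : forall i j, 0 <= B i j) (Bsym : B^T = B).
Hypotheses (vmax : argmax_lnorm r p B v) (v0 : nonneg_vec v).

Local Notation G := (lnorm p (B *m v)).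
Hypothesis G0 : 0 < G.

Let r1 : 1 < r. Proof. exact: lt_le_trans pr. Qed.
Let p0 : 0 < p. Proof. exact: lt_trans p1. Qed.
Let r0 : 0 < r. Proof. exact: lt_trans r1. Qed.

Lemma argmax_lnorm_le (x : 'cV[R]_n) : lnorm p (B *m x) <= G * lnorm r x.
Proof.
have [/eqP /(lnorm_eq0 (lt0r_neq0 r0)) ->|x0] := boolP (lnorm r x == 0).
  by rewrite mulmx0 !lnorm0// mulr0.
have {}x0 : 0 < lnorm r x by rewrite lt_neqAle eq_sym x0 lnorm_ge0.
have a0 : 0 <= (lnorm r x)^-1 by rewrite invr_ge0 lnorm_ge0.
have := (vmax.2 ((lnorm r x)^-1 *: x)).
rewrite (lnormZ x r0 a0) mulVf ?gt_eqF// => /(_ (lexx _)).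
have -> : B *m ((lnorm r x)^-1 *: x) = (lnorm r x)^-1 *: (B *m x) by rewrite [RHS]scalemxAr.
rewrite (lnormZ (B *m x) p0 a0).
rewrite ler_pdivrMl; last exact: x0.
move: (lnorm p (B *m x)) (lnorm r x) (lnorm p (B *m v)) => a b c.
by rewrite (mulrC b).

Qed.

Lemma argmax_normalized : \sum_i v i 0 `^ r = 1.
Proof.
have v1 : lnorm r v = 1.
  apply/eqP; rewrite eq_le vmax.1/=.
  by have := argmax_lnorm_le v; rewrite ler_pMr.
have := lnorm_powR v (lt0r_neq0 r0).
by rewrite v1 powR1 => /esym; under eq_bigr do rewrite ger0_norm//.
Qed.

Lemma mulmx_nonneg j : 0 <= (B *m v) j 0.
Proof. by rewrite mxE sumr_ge0// => k _; rewrite mulr_ge0. Qed.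

(** First-order optimality along [t e_i] with [t > 0] only: then [v + t e_i]
    stays nonnegative, and convexity bounds the objective from below while
    concavity of [x^(p/r)], where [p <= r] enters, bounds the norm from above. *)
Lemma argmax_gradient_le i :
  \sum_j B i j * (B *m v) j 0 `^ (p - 1) <= G `^ p * v i 0 `^ (r - 1).
Proof.
have step t : 0 < t ->
    \sum_j B i j * (B *m v) j 0 `^ (p - 1) <= G `^ p * (v i 0 + t) `^ (r - 1).
  move=> t0.
  pose x := v + t *: delta_mx i 0.
  have xE k : x k 0 = v k 0 + t * (k == i)%:R by rewrite !mxE eqxx andbT.
  have BxE j : (B *m x) j 0 = (B *m v) j 0 + t * B i j.
    rewrite mulmxDr -[B *m (t *: _)](scalemxAr t B) -colE !mxE; congr (_ + t * _).
    by rewrite -[in LHS]Bsym mxE.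
  have := argmax_lnorm_le x.
  have -> : lnorm p (B *m x) = (\sum_j ((B *m v) j 0 + t * B i j) `^ p) `^ p^-1.
    rewrite lnormE; congr (_ `^ _); apply: eq_bigr => j _.
    by rewrite BxE ger0_norm// addr_ge0 ?mulmx_nonneg// mulr_ge0// ltW.
  have -> : lnorm r x = (1 + ((v i 0 + t) `^ r - v i 0 `^ r)) `^ r^-1.
    rewrite lnormE; congr (_ `^ _); rewrite -argmax_normalized.
    rewrite (bigD1 i)//= [in RHS](bigD1 i)//= xE eqxx mulr1 ger0_norm; last first.
      by rewrite addr_ge0// ltW.
    rewrite [RHS]addrC addrA subrK; congr (_ + _).
    by apply: eq_bigr => k ki; rewrite xE (negbTE ki) mulr0 addr0 ger0_norm.
  set D := (v i 0 + t) `^ r - v i 0 `^ r => le1.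
  have D0 : 0 <= D.
    by rewrite subr_ge0 ge0_ler_powR ?nnegrE ?addr_ge0 ?lerDl// ltW.
  have S0 : 0 <= \sum_j ((B *m v) j 0 + t * B i j) `^ p.
    by apply: sumr_ge0 => j _; exact: powR_ge0.
  have le2 : \sum_j ((B *m v) j 0 + t * B i j) `^ p <= G `^ p * (1 + D) `^ (p / r).
    by apply: powR_root_le => //; rewrite ?powR_ge0// addr_ge0.
  have le3 : (1 + D) `^ (p / r) <= 1 + p / r * D.
    by apply: powR1D_le; rewrite ?divr_gt0// ler_pdivrMr// mul1r.
  have le4 : D <= r * (v i 0 + t) `^ (r - 1) * t.
    have := powR_sub_le r1 (v0 i) (_ : v i 0 <= v i 0 + t).
    by rewrite lerDl (ltW t0) addrAC subrr add0r; exact.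
  have le5 : G `^ p + p * t * \sum_j B i j * (B *m v) j 0 `^ (p - 1) <=
             \sum_j ((B *m v) j 0 + t * B i j) `^ p.
    rewrite lnorm_powR ?gt_eqF// mulr_sumr -big_split/=; apply: ler_sum => j _.
    rewrite ger0_norm ?mulmx_nonneg//.
    have := powR_above_tangent p1 (mulmx_nonneg j) (mulr_ge0 (ltW t0) (B0 i j)).
    by apply: le_trans; rewrite le_eqVlt; apply/orP; left; apply/eqP; ring.
  have Gp0 : 0 <= G `^ p by exact: powR_ge0.
  have le6 : G `^ p * (1 + D) `^ (p / r) <=
             G `^ p * (1 + p / r * (r * (v i 0 + t) `^ (r - 1) * t)).
    apply: ler_wpM2l => //; apply: (le_trans le3).
    by rewrite lerD2l ler_wpM2l ?divr_ge0// ltW.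
  have := le_trans le5 (le_trans le2 le6).
  rewrite mulrDr mulr1 lerD2l.
  rewrite (_ : G `^ p * _ = p * t * (G `^ p * (v i 0 + t) `^ (r - 1))).
    by rewrite ler_pM2l// mulr_gt0.
  by field; rewrite gt_eqF.
have cvg : G `^ p * (v i 0 + t) `^ (r - 1) @[t --> 0^'+] --> G `^ p * v i 0 `^ (r - 1).
  apply: cvgMl_tmp; have [vi0|vi0] := eqVneq (v i 0) 0.
    rewrite vi0 powR0 ?subr_eq0 ?gt_eqF//.
    under eq_fun do rewrite add0r.
    by apply: powR_cvg0; rewrite subr_gt0.
  have {}vi0 : 0 < v i 0 by rewrite lt_neqAle eq_sym vi0 v0.
  have cP : {for v i 0, continuous (fun u : R => u `^ (r - 1))}.
    apply: differentiable_continuous; apply/derivable1_diffP.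
    by apply: derivable_powR; rewrite in_itv/= andbT.
  have cD : v i 0 + t @[t --> (0 : R)^'+] --> v i 0.
    apply: (@cvg_at_right_filter _ _ (fun t => v i 0 + t)).
    rewrite -[X in _ --> X]addr0; apply: cvgD; first exact: cvg_cst.
    exact: cvg_id.
  exact: (cvg_comp _ _ cD cP).
rewrite -(cvg_lim _ cvg)//; apply: limr_ge; first by apply/cvg_ex; eexists; exact: cvg.
by near=> t; apply: step; near: t; exact: nbhs_right_gt.
Unshelve. all: by end_near. Qed.

(** One-sided perturbations only give one inequality in each coordinate. After
    multiplication by [v_i] and summation both sides equal [|Bv|_p^p], so the
    inequality is an equality wherever [v_i > 0]; where [v_i = 0] the larger
    side already vanishes. *)
Lemma argmax_stationary i :
  G `^ p * v i 0 `^ (r - 1) = \sum_j B i j * (B *m v) j 0 `^ (p - 1).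
Proof.
have ge0 k : 0 <= v k 0 * (G `^ p * v k 0 `^ (r - 1)
                 - \sum_j B k j * (B *m v) j 0 `^ (p - 1)).
  by rewrite mulr_ge0// subr_ge0 argmax_gradient_le.
have sum0 : \sum_k v k 0 * (G `^ p * v k 0 `^ (r - 1)
                 - \sum_j B k j * (B *m v) j 0 `^ (p - 1)) = 0.
  under eq_bigr do rewrite mulrBr mulrCA mulr_powRB1// mulr_sumr.
  rewrite sumrB -mulr_sumr argmax_normalized mulr1 exchange_big/=.
  rewrite lnorm_powR ?gt_eqF//; apply/eqP; rewrite subr_eq0; apply/eqP.
  apply: eq_bigr => j _; rewrite ger0_norm ?mulmx_nonneg//.
  rewrite -(mulr_powRB1 (mulmx_nonneg j) p0) [in X in X * _ = _]mxE mulr_suml.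
  apply: eq_bigr => k _.
  have -> : B k j = B j k by rewrite -[in LHS]Bsym mxE.
  by rewrite mulrA [v k 0 * _]mulrC.
have /allP/(_ i (mem_index_enum _))/= : all (fun k => v k 0 * (G `^ p * v k 0 `^ (r - 1)
                 - \sum_j B k j * (B *m v) j 0 `^ (p - 1)) == 0) (index_enum 'I_n).
  by rewrite -(@psumr_eq0 _ _ _ xpredT _)// sum0.
rewrite mulf_eq0 subr_eq0 => /orP[/eqP vi0|/eqP//].
apply/eqP; rewrite eq_le argmax_gradient_le andbT vi0 powR0 ?subr_eq0 ?gt_eqF//.
by rewrite mulr0 sumr_ge0// => j _; rewrite mulr_ge0// powR_ge0.
Qed.

End stationarity.

(** * Nearly constant solutions of the stationarity equation *)

Section near_constant.
Context {R : realType}.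

(** [B] maps bounded vectors close to constant ones, as seen from each of its
    rows; this is an average over [j], since a sparse matrix has rows that
    average badly. *)
Definition row_mixing n (B : 'M[R]_n) (delta : R) : Prop :=
  forall (x : 'cV[R]_n) (M : R), (forall k, `|x k 0| <= M) ->
  forall i, \sum_j B i j * `|(B *m x) j 0 - (\sum_k x k 0) / n%:R| <= delta * M.

Section fixed_point.
Variables (q s eps delta lam : R) (n : nat) (B : 'M[R]_n) (w : 'cV[R]_n).
Variable i0 : 'I_n.
Hypotheses (q0 : 0 < q) (eps0 : 0 <= eps).
Hypotheses (B0 : forall i j, 0 <= B i j).
Hypotheses (hB : forall i, 1 - eps <= \sum_j B i j <= 1 + eps).
Hypotheses (mix : row_mixing B delta).
Hypotheses (w01 : forall i, 0 <= w i 0 <= 1) (wi0 : w i0 0 = 1).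
Hypothesis hfix :
  forall i, lam * w i 0 `^ s = \sum_j B i j * (B *m w) j 0 `^ q.

Let t j := (B *m w) j 0.
Let c := (\sum_k w k 0) / n%:R.

Let n0 : (0 : R) < n%:R.
Proof. by rewrite ltr0n (leq_ltn_trans _ (ltn_ord i0)). Qed.

Let row_le i : \sum_j B i j <= 1 + eps.
Proof. by case/andP: (hB i). Qed.

Lemma image_range j : 0 <= (B *m w) j 0 <= 1 + eps.
Proof.
rewrite mxE sumr_ge0/=; last by move=> k _; rewrite mulr_ge0//; case/andP: (w01 k).
apply: le_trans (row_le j); apply: ler_sum => k _.
by rewrite ler_piMr//; case/andP: (w01 k).
Qed.

Lemma mean_range : 0 <= (\sum_k w k 0) / n%:R <= 1.
Proof.
apply/andP; split.
  by rewrite divr_ge0 ?(ltW n0)// sumr_ge0// => k _; case/andP: (w01 k).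
rewrite ler_pdivrMr// mul1r -[in leRHS](card_ord n) -sumr_const.
by apply: ler_sum => k _; case/andP: (w01 k).
Qed.

(** The fixed-point equation is compared at [i] and at the index [i0] of the
    largest entry: the sums on its right-hand side differ only through the row
    sums and the oscillation of [(Bw)_j^q]. *)
Lemma spread_le_oscillation D i :
    (forall i, \sum_j B i j * `|t j `^ q - c `^ q| <= D) ->
  lam * (1 - w i 0 `^ s) <= 2 * eps + 2 * D.
Proof.
move=> hD.
have hi k : `|lam * w k 0 `^ s - (\sum_j B k j) * c `^ q| <= D.
  rewrite hfix mulr_suml -sumrB; apply: le_trans (hD k).
  apply: (le_trans (ler_norm_sum _ _ _)); apply: ler_sum => j _.
  by rewrite -mulrBr normrM ger0_norm.
have /ler_normlP[_ h1] := hi i0; have /ler_normlP[h2 _] := hi i.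
move: h1; rewrite wi0 powR1 mulr1 => h1.
have cq0 : 0 <= c `^ q by exact: powR_ge0.
have cq1 : c `^ q <= 1.
  rewrite -[leRHS](one_powR q).
  by case/andP: mean_range => *; rewrite ge0_ler_powR ?nnegrE// ltW.
have : (\sum_j B i0 j - \sum_j B i j) * c `^ q <= 2 * eps.
  apply: (@le_trans _ _ (2 * eps * c `^ q)); last by rewrite ler_piMr// mulr_ge0.
  rewrite ler_wpM2r//; have /andP[b1 _] := hB i; have /andP[_ b4] := hB i0.
  lra.
by rewrite mulrBl mulrBr mulr1; lra.
Qed.

Lemma mean_oscillation_le i : \sum_j B i j * `|t j - c| <= delta.
Proof.
have := mix (x := w) (M := 1); rewrite mulr1; apply => l.
by have /andP[? ?] := w01 l; rewrite ger0_norm.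
Qed.

Section lower_bound.
Variable m : R.
Hypothesis m01 : 0 <= m <= 1.
Hypothesis hm : forall k, m <= w k 0.

Let x : 'cV[R]_n := w - const_mx m.

Let xE k : x k 0 = w k 0 - m.
Proof. by rewrite !mxE. Qed.

Let x0 k : 0 <= x k 0.
Proof. by rewrite xE subr_ge0. Qed.

Let Bx j : (B *m x) j 0 = t j - (\sum_k B j k) * m.
Proof.
rewrite mxE; under eq_bigr do rewrite xE mulrBr.
by rewrite sumrB -mulr_suml /t [in RHS]mxE.
Qed.

Lemma image_ge j : (1 - eps) * m <= (B *m w) j 0.
Proof.
have : 0 <= (B *m x) j 0 by rewrite mxE sumr_ge0// => k _; rewrite mulr_ge0.
rewrite Bx subr_ge0; apply: le_trans; rewrite ler_wpM2r//; first by case/andP: m01.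
by case/andP: (hB j).
Qed.

Let mean_x : (\sum_k x k 0) / n%:R = c - m.
Proof.
under eq_bigr do rewrite xE.
rewrite sumrB sumr_const card_ord mulrBl -/c -(mulr_natr m) mulfK//.
by rewrite gt_eqF.
Qed.

Lemma mean_ge : m <= (\sum_k w k 0) / n%:R.
Proof.
by rewrite -subr_ge0 -mean_x divr_ge0 ?(ltW n0)// sumr_ge0.
Qed.

(** Mixing is applied to the deviation [w - m] instead of [w]: the constant part
    [m] is moved by the errors of the row sums alone, which is why the bound
    splits into a multiple of [eps] and a small multiple of the spread [1 - m]
    itself. *)
Lemma centred_oscillation_le i :
  \sum_j B i j * `|t j - c| <= (1 + eps) * eps + delta * (1 - m).
Proof.
have /andP[m0 m1] := m01.
have hx k : `|x k 0| <= 1 - m.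
  by rewrite ger0_norm// xE lerD2r; case/andP: (w01 k).
have hmx := mix hx i.
apply: (@le_trans _ _ (\sum_j (B i j * eps +
          B i j * `|(B *m x) j 0 - (\sum_k x k 0) / n%:R|))).
  apply: ler_sum => j _; rewrite -mulrDr ler_wpM2l// Bx mean_x.
  have -> : t j - c = (\sum_k B j k - 1) * m +
      (t j - (\sum_k B j k) * m - (c - m)) by ring.
  apply: (le_trans (ler_normD _ _)); rewrite lerD2r normrM (ger0_norm m0).
  have hb : `|\sum_k B j k - 1| <= eps.
    by have /andP[? ?] := hB j; rewrite ler_norml; apply/andP; split; lra.
  by apply: le_trans hb; rewrite ler_piMr.
by rewrite big_split/= -mulr_suml lerD// ler_wpM2r.
Qed.

End lower_bound.
End fixed_point.

(** A crude bound (mean_oscillation_le) first brings all entries within [om] of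
    the largest one, where powers are almost linear. The fine bound
    (centred_oscillation_le) then reads
    [(r - 1) h <= 2 eps + 2 (p - 1) (eps + delta h)] for the spread [h], up to
    factors within 1/100 of 1; its solution is slightly above [2 p / (r - 1) eps],
    which the constant 53/25 covers. *)
Lemma fixed_point_flat (p r : R) : 1 < p -> p <= r ->
  exists eps0 delta : R, [/\ 0 < eps0, 0 < delta &
  forall n (B : 'M[R]_n) (w : 'cV[R]_n) (eps lam : R) i0, 0 <= eps <= eps0 ->
    (forall i j, 0 <= B i j) ->
    (forall i, 1 - eps <= \sum_j B i j <= 1 + eps) ->
    row_mixing B delta ->
    (forall i, 0 <= w i 0 <= 1) -> w i0 0 = 1 ->
    (1 - eps) `^ p <= lam ->
    (forall i, lam * w i 0 `^ (r - 1) = \sum_j B i j * (B *m w) j 0 `^ (p - 1)) ->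
  forall i, 1 - w i 0 <= 53 / 25 * p / (r - 1) * eps].
Proof.
move=> p1 pr; pose q := p - 1; pose s := r - 1.
have q0 : 0 < q by rewrite subr_gt0.
have qs : q <= s by rewrite lerD2r.
have s0 : 0 < s by exact: lt_le_trans qs.
(* The exponents occur in the two derivatives and in the bound on [lam]. *)
have tau0 : (0 : R) < 100^-1 by rewrite invr_gt0.
have [w1 w10 hw1] := powR_near1 (q - 1) tau0.
have [w2 w20 hw2] := powR_near1 (s - 1) tau0.
have [w3 w30 hw3] := powR_near1 p tau0.
pose om := Num.min 10^-1 (Num.min w1 (Num.min w2 w3)) / 2.
have om0 : 0 < om by rewrite divr_gt0// !lt_min w10 w20 w30 invr_gt0 ltr0n.
have [om1 omw1 omw2 omw3] : [/\ 2 * om <= 10^-1, 2 * om <= w1, 2 * om <= w2 & 2 * om <= w3].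
  rewrite [2 * om]mulrC divfK ?pnatr_eq0//.
  by rewrite !ge_min !lexx ?orbT.
move: om om0 om1 omw1 omw2 omw3 => om om0 om1 omw1 omw2 omw3.
have om_lt1 : om < 1 by clear -om1; lra.
(* The spread of [w^s] is at most [10 be] once its errors are below [be]; this
   says that all entries are at least [1 - om]. *)
pose be := (1 - (1 - om) `^ s) / 10.
have beE : 10 * be = 1 - (1 - om) `^ s by rewrite mulrC divfK ?pnatr_eq0.
have be0 : 0 < be.
  rewrite divr_gt0// subr_gt0 -[ltRHS](one_powR s).
  by rewrite gt0_ltr_powR// ?nnegrE ?subr_ge0 ?(ltW om_lt1)// ltrBlDr ltrDl.
move: be beE be0 => be beE be0.
have [K K0 hK] := powR_modulus q0 be0.
exists (Num.min 100^-1 (Num.min om be)), (Num.min 300^-1 (be / K)).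
split; first by rewrite !lt_min om0 be0 !andbT invr_gt0 ltr0n.
  by rewrite lt_min divr_gt0// andbT invr_gt0 ltr0n.
move=> n B w eps lam i0 /andP[e0]; rewrite !le_min => /and3P[e1 e2 e3].
have [d1 d2] : Num.min 300^-1 (be / K) <= 300^-1 /\ K * Num.min 300^-1 (be / K) <= be.
  split; first by rewrite ge_min lexx.
  by rewrite -ler_pdivlMl// [K^-1 * _]mulrC ge_min lexx orbT.
have delta0 : 0 < Num.min 300^-1 (be / K).
  by rewrite lt_min divr_gt0// andbT invr_gt0 ltr0n.
move: (Num.min 300^-1 (be / K)) d1 d2 delta0 => delta d1 d2 delta0.
move=> B0 hB mix w01 wi0 hlam hfix.
have lam1 : 99 / 100 <= lam.
  apply: le_trans hlam; have /andP[+ _] : 1 - 100^-1 <= (1 - eps) `^ p <= 1 + 100^-1.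
    by apply: hw3; clear -e0 e2 omw3 om0; apply/andP; split; lra.
  by move: (_ `^ _) => z; clear; lra.
pose t j := (B *m w) j 0.
pose c := (\sum_k w k 0) / n%:R.
have t_range j : 0 <= t j <= 1 + eps by exact: image_range.
have c_range : 0 <= c <= 1 by exact: mean_range w01.
have spread := spread_le_oscillation q0 e0 B0 hB w01 wi0 hfix.
have wom i : 1 - om <= w i 0.
  have osc k : \sum_j B k j * `|t j `^ q - c `^ q| <= be * (1 + eps) + K * delta.
    apply: (@le_trans _ _ (\sum_j B k j * (be + K * `|t j - c|))).
      apply: ler_sum => j _; rewrite ler_wpM2l//; apply: hK.
        by case/andP: (t_range j) => -> /= h; clear -h e1; lra.
      by case/andP: c_range => -> /= h; clear -h; lra.
    have -> : \sum_j B k j * (be + K * `|t j - c|) =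
        (\sum_j B k j) * be + K * (\sum_j B k j * `|t j - c|).
      rewrite mulr_suml mulr_sumr -big_split/=; apply: eq_bigr => j _.
      by rewrite mulrDr [B k j * (K * _)]mulrCA.
    apply: lerD; first by rewrite mulrC ler_wpM2l ?(ltW be0)//; case/andP: (hB k).
    rewrite ler_wpM2l ?(ltW K0)//.
    exact: mean_oscillation_le.
  have h := spread _ i osc.
  have ws : (1 - om) `^ s <= w i 0 `^ s.
    have : lam * (1 - w i 0 `^ s) <= lam * (10 * be).
      apply: (le_trans h); apply: (@le_trans _ _ (99/100 * (10 * be))).
        have bee : be * eps <= be * 100^-1 by rewrite ler_pM2l.
        by clear -bee e3 d2 be0; lra.
      by rewrite ler_wpM2r// ltW// mulr_gt0.
    have lam0 : 0 < lam by clear -lam1; lra.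
    by rewrite ler_pM2l// beE lerD2l lerN2.
  have /andP[wi00 _] := w01 i.
  rewrite leNgt; apply/negP => wlt; move: ws; rewrite leNgt.
  by rewrite gt0_ltr_powR// nnegrE// subr_ge0 ltW.
have [im _ him] : exists2 im, true & forall i, w im 0 <= w i 0.
  exists [arg min_(i < i0) w i 0]%O => //.
  by case: arg_minP => // i _ hi k; exact: hi.
pose m := w im 0; pose h := 1 - m.
have m01 : 0 <= m <= 1 by exact: w01.
have /andP[m0 m1] := m01.
have h0 : 0 <= h by rewrite subr_ge0.
have mom : 1 - om <= m by exact: wom.
have c_int : 1 - 2 * om <= c <= 1 + 2 * om.
  have mc : m <= c by exact: (mean_ge i0 him).
  by case/andP: c_range => _ c1; clear -c1 mc mom om0; apply/andP; split; lra.
have t_int j : 1 - 2 * om <= t j <= 1 + 2 * om.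
  have tm : (1 - eps) * m <= t j by exact: (image_ge B0 hB m01 him).
  have /andP[_ t2] := t_range j.
  have om2 : (1 - om) * (1 - om) <= (1 - eps) * m.
    by apply: ler_pM => //; rewrite ?subr_ge0 ?(ltW om_lt1)// lerD2l lerN2.
  have om3 : 0 <= om * om by rewrite mulr_ge0 // ltW.
  by clear -tm om2 om3 t2 e2 om0; apply/andP; split; lra.
have osc i : \sum_j B i j * `|t j `^ q - c `^ q| <=
    q * (101 / 100) * ((1 + eps) * eps + delta * h).
  apply: (@le_trans _ _ (\sum_j q * (101 / 100) * (B i j * `|t j - c|))).
    apply: ler_sum => j _; rewrite mulrCA ler_wpM2l//.
    apply: (powR_lipschitz q0 _ _ (t_int j) c_int); first by clear -om1; lra.
    move=> z hz; have /andP[_] : 1 - 100^-1 <= z `^ (q - 1) <= 1 + 100^-1.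
      by apply: hw1; case/andP: hz; clear -omw1 => *; apply/andP; split; lra.
    by move: (z `^ _) => y; clear; lra.
  rewrite -mulr_sumr; apply: ler_wpM2l; first by rewrite mulr_ge0// ltW.
  exact: (centred_oscillation_le i0 e0 B0 hB mix w01 m01 him).
have := spread _ im osc; rewrite -/m => hsp.
have hms : s * (99 / 100) * h <= 1 - m `^ s.
  have m_gt0 : 0 < m by clear -mom om1; lra.
  have [z /andP[mz z1]] := powR_mean_value s m_gt0 m1.
  rewrite powR1 => ->; rewrite -/h ler_wpM2r// ler_wpM2l ?(ltW s0)//.
  have /andP[+ _] : 1 - 100^-1 <= z `^ (s - 1) <= 1 + 100^-1.
    by apply: hw2; clear -mom mz z1 om0 omw2; apply/andP; split; lra.
  by move: (z `^ _) => y; clear; lra.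
have sh0 : 0 <= s * h by rewrite mulr_ge0// ltW.
have hl : 99 / 100 * (s * (99 / 100) * h) <= lam * (1 - m `^ s).
  by apply: ler_pM => //; rewrite ?mulr_ge0 ?invr_ge0 ?(ltW s0).
have hdel : q * (delta * h) <= s * (300^-1 * h).
  by apply: ler_pM => //; rewrite ?(ltW q0) ?mulr_ge0 ?(ltW delta0)// ler_wpM2r.
have heps : q * ((1 + eps) * eps) <= q * (101 / 100 * eps).
  by rewrite ler_pM2l// ler_wpM2r//; clear -e1; lra.
have qe : 0 <= q * eps by rewrite mulr_ge0// ltW.
have key : s * h <= 53 / 25 * p * eps.
  have pE : p * eps = q * eps + eps by rewrite /q; ring.
  by rewrite -mulrA pE; clear -hsp hl hdel heps qe sh0 e0; lra.
move=> i; apply: (@le_trans _ _ h); first by rewrite /h lerD2l lerN2 him.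
by rewrite -/s mulrAC ler_pdivlMr// mulrC.
Qed.

End near_constant.

(** * Maximizers of mixing matrices *)

Section argmax_flat.
Context {R : realType}.

(** Dividing by the largest entry turns the stationarity equation into the
    normalized one above. The constant vector as a competitor bounds the norm
    from below, hence also the factor [lam]; the normalization [sum v_i^r = 1]
    puts [n^(-1/r)] between the smallest and the largest entry. *)
Lemma argmax_flat (p r : R) : 1 < p -> p <= r ->
  exists eps0 delta : R, [/\ 0 < eps0, 0 < delta &
  forall n (B : 'M[R]_n) (v : 'cV[R]_n) (eps : R), (0 < n)%N -> 0 <= eps <= eps0 ->
    (forall i j, 0 <= B i j) -> B^T = B ->
    (forall i, 1 - eps <= \sum_j B i j <= 1 + eps) ->
    row_mixing B delta ->
    argmax_lnorm r p B v -> nonneg_vec v ->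
  forall i, `|v i 0 - n%:R `^ (- r^-1)| <= 11 / 5 * p / (r - 1) * eps * n%:R `^ (- r^-1)].
Proof.
move=> p1 pr; have [eps1 [delta [eps10 delta0 flat]]] := fixed_point_flat p1 pr.
have p0 : 0 < p by exact: lt_trans p1.
have r1 : 1 < r by exact: lt_le_trans pr.
have r0 : 0 < r by exact: lt_trans r1.
have s0 : 0 < r - 1 by rewrite subr_gt0.
pose C := 53 / 25 * p / (r - 1).
have C0 : 0 < C by rewrite divr_gt0// mulr_gt0// divr_gt0.
exists (Num.min eps1 (Num.min 2^-1 (100^-1 / C))), delta; split => //.
  by rewrite !lt_min eps10 divr_gt0 ?andbT//= invr_gt0 ltr0n.
move=> n B v eps n0 /andP[e0]; rewrite !le_min => /and3P[e1 e2 e3] B0 Bsym hB mix vmax v0 i.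
have n0R : 0 < n%:R :> R by rewrite ltr0n.
have n1R : 1 <= n%:R :> R by rewrite ler1n.
pose a := n%:R `^ (- r^-1) : R.
have a0 : 0 < a by exact: powR_gt0.
have ar : a `^ r = n%:R^-1.
  by rewrite /a -powRrM mulNr mulVf ?gt_eqF// powR_inv1// ltW.
have Gle : n%:R * ((1 - eps) * a) `^ p <= lnorm p (B *m v) `^ p.
  have a1 : lnorm r (a *: const_mx 1 : 'cV[R]_n) <= 1.
    rewrite lnormZ ?(ltW a0)// lnormE.
    under eq_bigr do rewrite mxE normr1 powR1.
    rewrite sumr_const card_ord -powRD; last by rewrite (lt0r_neq0 n0R) implybT.
    by rewrite addNr powRr0.
  have le1 := vmax.2 _ a1.
  have : lnorm p (B *m (a *: const_mx 1 : 'cV[R]_n)) `^ p <= lnorm p (B *m v) `^ p.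
    exact: (ge0_ler_powR (ltW p0) (lnorm_ge0 _ _) (lnorm_ge0 _ _) le1).
  apply: le_trans; rewrite lnorm_powR ?gt_eqF//.
  rewrite -[in leLHS](card_ord n) mulr_natl -sumr_const; apply: ler_sum => j _.
  have -> : (B *m (a *: const_mx 1 : 'cV[R]_n)) j 0 = (\sum_k B j k) * a.
    by rewrite mxE mulr_suml; apply: eq_bigr => k _; rewrite !mxE mulr1.
  have /andP[b1 _] := hB j.
  have e1' : 0 <= 1 - eps by clear -e2; lra.
  rewrite ger0_norm; last by rewrite mulr_ge0 ?(ltW a0)// (le_trans _ b1).
  rewrite ge0_ler_powR ?nnegrE ?(ltW p0)// ?mulr_ge0 ?(ltW a0)//.
    by rewrite (le_trans _ b1).
  by rewrite ler_wpM2r// ltW.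
have e1' : 0 < 1 - eps by clear -e2; lra.
have G0 : 0 < lnorm p (B *m v).
  rewrite lt_neqAle lnorm_ge0 andbT eq_sym; apply/eqP => G0; move: Gle.
  rewrite G0 powR0 ?gt_eqF// leNgt => /negP; apply.
  by rewrite mulr_gt0// powR_gt0// mulr_gt0.
have vnorm := argmax_normalized p1 pr vmax v0 G0.
have vstat := argmax_stationary p1 pr B0 Bsym vmax v0 G0.
move: (lnorm p (B *m v)) G0 Gle vstat => G G0 Gle vstat.
pose i0 := [arg max_(k > i) v k 0]%O.
pose V := v i0 0.
have Vmax k : v k 0 <= V.
  by rewrite /V /i0; case: arg_maxP => // l _ hl; exact: hl.
have aV : a <= V.
  rewrite leNgt; apply/negP => Va.
  have : \sum_k v k 0 `^ r < 1.
    apply: (@lt_le_trans _ _ (\sum_(k < n) a `^ r)).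
      apply: ltr_sum; first by rewrite has_predT /index_enum -enumT size_enum_ord.
      by move=> k _; rewrite gt0_ltr_powR ?nnegrE ?(ltW a0)// (le_lt_trans (Vmax k)).
    by rewrite sumr_const card_ord ar -(mulr_natr n%:R^-1) mulVf// gt_eqF.
  by rewrite vnorm ltxx.
have V0 : 0 < V by exact: lt_le_trans aV.
have [k0 hk0] : exists k, v k 0 <= a.
  apply/not_existsP => h.
  have : 1 < \sum_k v k 0 `^ r.
    apply: (@le_lt_trans _ _ (\sum_(k < n) a `^ r)).
      by rewrite sumr_const card_ord ar -(mulr_natr n%:R^-1) mulVf// gt_eqF.
    apply: ltr_sum; first by rewrite has_predT /index_enum -enumT size_enum_ord.
    move=> k _; rewrite gt0_ltr_powR ?nnegrE ?(ltW a0)//.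
    by have /negP := h k; rewrite -ltNge.
  by rewrite vnorm ltxx.
pose w := V^-1 *: v.
have wE k : w k 0 = V^-1 * v k 0 by rewrite mxE.
have w01 k : 0 <= w k 0 <= 1.
  by rewrite wE mulr_ge0 ?invr_ge0 ?(ltW V0)//= ler_pdivrMl// mulr1.
have wi0 : w i0 0 = 1 by rewrite wE mulVf ?gt_eqF.
pose lam := G `^ p * V `^ (r - p).
have lamge : (1 - eps) `^ p <= lam.
  have -> : (1 - eps) `^ p = n%:R * ((1 - eps) * a) `^ p * a `^ (r - p).
    rewrite powRM ?(ltW e1') ?(ltW a0)// -!mulrA -powRD; last by rewrite (lt0r_neq0 a0) implybT.
    by rewrite (addrC p) subrK ar mulrCA mulfV ?gt_eqF// mulr1.
  apply: ler_pM => //; rewrite ?mulr_ge0 ?powR_ge0//.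
  by rewrite ge0_ler_powR ?nnegrE ?subr_ge0 ?(ltW a0) ?(ltW V0).
have wfix k : lam * w k 0 `^ (r - 1) = \sum_j B k j * (B *m w) j 0 `^ (p - 1).
  have Bw j : (B *m w) j 0 = V^-1 * (B *m v) j 0.
    rewrite !mxE mulr_sumr; apply: eq_bigr => l _.
    by rewrite wE mulrCA.
  under eq_bigr => j _.
    rewrite Bw powRM ?invr_ge0 ?(ltW V0)//; last exact: mulmx_nonneg.
    rewrite mulrCA.
    over.
  rewrite -mulr_sumr -vstat wE powRM ?invr_ge0 ?(ltW V0)// /lam.
  have Vs : V `^ (r - p) * V^-1 `^ (r - 1) = V^-1 `^ (p - 1).
    rewrite -!powR_inv1 ?(ltW V0)// -!powRrM !mulN1r -powRD; last by rewrite (lt0r_neq0 V0) implybT.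
    by congr (_ `^ _); ring.
  by rewrite -Vs; ring.
have thE k : 1 - w k 0 <= C * eps.
  have ee : 0 <= eps <= eps1 by rewrite e0.
  exact: (flat n B w eps lam i0 ee B0 hB mix w01 wi0 lamge wfix).
have Ce : C * eps <= 100^-1 by rewrite mulrC -ler_pdivlMr.
have Ce0 : 0 <= C * eps by rewrite mulr_ge0// ltW.
have vV k : V * (1 - C * eps) <= v k 0.
  by rewrite -ler_pdivlMl// -wE; have := thE k; clear; lra.
have VCe : V * (C * eps) <= V * 100^-1 by rewrite ler_pM2l.
have Va : V <= 100 / 99 * a.
  by have := le_trans (vV k0) hk0; clear -VCe; rewrite mulrBr mulr1; lra.
have VCa : V * (C * eps) <= 100 / 99 * a * (C * eps) by rewrite ler_wpM2r.
have -> : 11 / 5 * p / (r - 1) * eps * a = 55 / 53 * (a * (C * eps)).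
  by rewrite /C; field; rewrite gt_eqF.
have aC : 0 <= a * (C * eps) by rewrite mulr_ge0// ltW.
have h1 := vV i; have h2 := vV k0; have h3 := Vmax i.
rewrite -/a ler_norml; apply/andP.
move: h1 h2; rewrite mulrBr mulr1 => h1 h2.
move: VCa aC h1 h2 h3 hk0 aV; clear.
rewrite -!mulrA; move: (a * _) => A; move: (V * _) => W *.
by split; lra.
Qed.

End argmax_flat.

(** * Mixing from cut deviations *)

Section cut_mixing.
Context {R : realType}.

(** The deviation of the entries from [mu]; the diagonal of the random matrix
    is 0, not [mu], and is left out. *)
Definition centred n (mu : R) (A : 'M[R]_n) (j k : 'I_n) : R :=
  if j == k then 0 else A j k - mu.

Section deterministic.
Variables (n : nat) (A : 'M[R]_n) (mu delta L C N : R).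
Hypotheses (n1 : (1 < n)%N) (mu0 : 0 < mu) (C0 : 0 < C).
Hypotheses (NE : N = (n.-1)%:R * mu) (delta0 : 0 <= delta).
Hypotheses (A0 : forall i j, 0 <= A i j) (AL : forall i j, A i j <= L).
Hypothesis Adiag : forall i, A i i = 0.
Hypothesis Arow : forall i, \sum_j A i j <= 2 * N.
Hypothesis Acut : forall T S : {set 'I_n}, C <= #|T|%:R * mu ->
  \sum_k (if k \in S then 1 else -1) * \sum_(j in T) centred mu A j k
    <= delta * N * #|T|%:R.

Let dev (x : 'cV[R]_n) j := \sum_k centred mu A j k * x k 0.

Let n10 : (0 : R) < n.-1%:R.
Proof. by rewrite ltr0n; case: (n) n1 => [|[]]. Qed.

Let N0 : 0 < N. Proof. by rewrite NE mulr_gt0. Qed.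

Let nE : n%:R = n.-1%:R + 1 :> R.
Proof. by rewrite natr1 prednK// (ltn_trans _ n1). Qed.

(** If the deviations at all indices of a large set exceeded their threshold, so
    would their sum, whereas the best choice of signs bounds that sum for all
    vectors [x] with entries at most [M] in absolute value. *)
Lemma few_large_deviations (x : 'cV[R]_n) M : (forall k, `|x k 0| <= M) -> 0 <= M ->
  #|[set j | delta * N * M < dev x j]%SET|%:R * mu < C.
Proof.
move=> xM M0; set T := [set j | _]%SET; rewrite ltNge; apply/negP => CT.
have T0 : (0 < #|T|)%N.
  rewrite lt0n; apply: contraTneq CT => ->.
  by rewrite mul0r -ltNge.
have lo : \sum_(j in T) (delta * N * M) < \sum_(j in T) dev x j.
  apply: ltr_sum; last by move=> j; rewrite inE.
  by move/card_gt0P : T0 => [j jT]; apply/hasP; exists j; rewrite ?mem_index_enum.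
pose c k := \sum_(j in T) centred mu A j k.
have up : \sum_(j in T) dev x j <= M * \sum_k `|c k|.
  rewrite /dev exchange_big mulr_sumr; apply: ler_sum => k _.
  rewrite -mulr_suml -/(c k) mulrC; apply: le_trans (ler_norm _) _.
  by rewrite normrM ler_wpM2r.
have cT : \sum_k `|c k| <= delta * N * #|T|%:R.
  have := @Acut T [set k | 0 <= c k]%SET CT; congr (_ <= _).
  apply: eq_bigr => k _; rewrite inE -/(c k).
  by case: (leP 0 (c k)) => ck; [rewrite mul1r ger0_norm|rewrite mulN1r ltr0_norm].
have := lt_le_trans lo (le_trans up (ler_wpM2l M0 cT)).
by rewrite sumr_const -[X in X < _]mulr_natr mulrCA mulrA ltxx.
Qed.

Let devE x j : dev x j = (A *m x) j 0 - mu * (\sum_k x k 0 - x j 0).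
Proof.
have -> : mu * (\sum_k x k 0 - x j 0) = \sum_k mu * (x k 0 - (k == j)%:R * x k 0).
  rewrite -mulr_sumr sumrB; congr (mu * (_ - _)).
  rewrite (bigD1 j)//= eqxx mul1r big1 ?addr0// => k kj.
  by rewrite (negbTE kj) mul0r.
rewrite mxE -sumrB; apply: eq_bigr => k _; rewrite /centred eq_sym.
by case: eqVneq => [->|_] /=; rewrite ?Adiag; ring.
Qed.

Let devN x j : dev (- x) j = - dev x j.
Proof. by rewrite /dev -sumrN; apply: eq_bigr => k _; rewrite mxE mulrN. Qed.

Let dev_le (x : 'cV[R]_n) M j : (forall k, `|x k 0| <= M) -> `|dev x j| <= 3 * N * M.
Proof.
move=> xM; rewrite devE; apply: (le_trans (ler_normB _ _)).
have M0 : 0 <= M by apply: le_trans (xM j).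
have h1 : `|(A *m x) j 0| <= 2 * N * M.
  rewrite mxE; apply: (le_trans (ler_norm_sum _ _ _)).
  apply: (@le_trans _ _ (\sum_k A j k * M)).
    by apply: ler_sum => k _; rewrite normrM ger0_norm// ler_wpM2l.
  by rewrite -mulr_suml ler_wpM2r.
have h2 : `|mu * (\sum_k x k 0 - x j 0)| <= N * M.
  rewrite normrM gtr0_norm// NE [n.-1%:R * mu]mulrC -mulrA ler_wpM2l ?(ltW mu0)//.
  rewrite (bigD1 j)//= [_ + _ - x j 0]addrAC subrr add0r.
  apply: (le_trans (ler_norm_sum _ _ _)).
  apply: (@le_trans _ _ (\sum_(k | k != j) M)); first exact: ler_sum.
  rewrite sumr_const -[leLHS]mulr_natl ler_wpM2r// ler_nat.
  by rewrite cardC1 card_ord.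
lra.
Qed.

(** The three terms come from the indices with small deviation, from the
    exceptional ones (at most [2 C / mu], each of weight at most [L] and with
    deviation at most [3 N M]), and from the vanishing diagonal together with
    the two normalizations [n] and [n - 1]. *)
Lemma row_mixing_of_cut :
  row_mixing (N^-1 *: A) (2 * delta + 6 * C * L / (mu * N) + 4 / n.-1%:R).
Proof.
move=> x M xM i.
have M0 : 0 <= M by apply: le_trans (xM i).
have L0 : 0 <= L by apply: le_trans (AL i i).
have n0 : 0 < n%:R :> R by rewrite nE addr_gt0.
pose Tp := [set j | delta * N * M < dev x j]%SET.
pose Tm := [set j | delta * N * M < dev (- x) j]%SET.
have cp : #|Tp|%:R * mu < C by exact: few_large_deviations.
have cm : #|Tm|%:R * mu < C.
  by apply: few_large_deviations => // k; rewrite mxE normrN.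
have dN : 0 <= delta * N * M by rewrite !mulr_ge0// ltW.
have NM : 0 <= 3 * N * M by rewrite !mulr_ge0// ltW.
have pw j : A i j * `|dev x j| <= A i j * (delta * N * M)
    + ((j \in Tp)%:R + (j \in Tm)%:R) * (L * (3 * N * M)).
  have LNM : 0 <= L * (3 * N * M) by rewrite mulr_ge0.
  have big : A i j * `|dev x j| <= L * (3 * N * M).
    by apply: ler_pM => //; exact: dev_le.
  have Ad : 0 <= A i j * (delta * N * M) by rewrite mulr_ge0.
  move: Ad big LNM; rewrite !inE devN.
  case: ltP => h1; case: ltP => h2 /= Ad big LNM; only 1-3: lra.
  by rewrite addr0 mul0r addr0 ler_wpM2l// ler_norml h1 andbT lerNl.
have S1 : \sum_j A i j * `|dev x j| <=
    2 * N * (delta * N * M) + (2 * C / mu) * (L * (3 * N * M)).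
  apply: (le_trans (ler_sum _ (fun j _ => pw j))).
  rewrite big_split/= -!mulr_suml; apply: lerD; first by rewrite ler_wpM2r.
  apply: ler_wpM2r; first exact: mulr_ge0.
  rewrite big_split/= -!natr_sum.
  have cardE (T : {set 'I_n}) : (\sum_(j < n) (j \in T))%N = #|T|.
    by rewrite -sum1_card [RHS]big_mkcond; apply: eq_bigr => j _; case: (j \in T).
  rewrite !cardE ler_pdivlMr// mulrDl -[2]natr1 mulrDl mul1r.
  by apply: lerD; exact: ltW.
have n1M : 0 <= M / n.-1%:R by rewrite divr_ge0// ltW.
have pw2 j : (N^-1 *: A) i j * `|(N^-1 *: A *m x) j 0 - (\sum_k x k 0) / n%:R| <=
    N^-1 * N^-1 * (A i j * `|dev x j|) + A i j * (N^-1 * (2 * (M / n.-1%:R))).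
  have Sx : `|\sum_k x k 0| <= n%:R * M.
    apply: (le_trans (ler_norm_sum _ _ _)).
    apply: (@le_trans _ _ (\sum_(k < n) M)); first exact: ler_sum.
    by rewrite sumr_const card_ord mulr_natl.
  have -> : (N^-1 *: A *m x) j 0 - (\sum_k x k 0) / n%:R =
      N^-1 * dev x j + ((\sum_k x k 0) / n%:R - x j 0) / n.-1%:R.
    have -> : (N^-1 *: A *m x) j 0 = N^-1 * (A *m x) j 0.
      by rewrite -scalemxAl mxE.
    rewrite devE NE nE; field.
    by rewrite -nE !gt_eqF.
  have err : `|((\sum_k x k 0) / n%:R - x j 0) / n.-1%:R| <= 2 * (M / n.-1%:R).
    rewrite normrM normfV (gtr0_norm n10) mulrA ler_wpM2r ?invr_ge0 ?(ltW n10)//.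
    apply: (le_trans (ler_normB _ _)).
    rewrite -[2]natr1 mulrDl mul1r lerD// normrM normfV (gtr0_norm n0).
    by rewrite ler_pdivrMr// mulrC.
  rewrite mxE [leLHS]mulrAC.
  apply: (@le_trans _ _ (N^-1 * (N^-1 * `|dev x j| + 2 * (M / n.-1%:R)) * A i j)).
    rewrite ler_wpM2r// ler_wpM2l ?invr_ge0 ?(ltW N0)//.
    apply: (le_trans (ler_normD _ _)); apply: lerD => //.
    by rewrite normrM gtr0_norm ?invr_gt0.
  by rewrite le_eqVlt; apply/orP; left; apply/eqP; ring.
apply: (le_trans (ler_sum _ (fun j _ => pw2 j))).
rewrite big_split/= -mulr_sumr -mulr_suml.
have N20 : 0 <= N^-1 * N^-1 by rewrite mulr_ge0 ?invr_ge0 ?ltW.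
have h1 := ler_wpM2l N20 S1.
have Q0 : 0 <= N^-1 * (2 * (M / n.-1%:R)) by rewrite !mulr_ge0 ?invr_ge0 ?(ltW N0).
have h2 := ler_wpM2r Q0 (Arow i).
apply: (le_trans (lerD h1 h2)).
rewrite le_eqVlt; apply/orP; left; apply/eqP; field.
by rewrite !gt_eqF.
Qed.

End deterministic.
End cut_mixing.

(** * Independence and products of expectations *)

Section product_expectation.
Context d (T : measurableType d) (R : realType) (P : probability T R).
Local Open Scope ereal_scope.

Import HBNNSimple.

(** An identity between a weighted and an unweighted integral passes from
    indicators to simple functions, and by monotone convergence to nonnegative
    functions. *)
Lemma integral_weighted_comp (X G : T -> R) (c : R) :
    measurable_fun setT X -> measurable_fun setT G ->
    (forall w, (0 <= G w)%R) -> (0 <= c)%R ->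
    (forall B, measurable B ->
       \int[P]_w (\1_B (X w) * G w)%:E = P (X @^-1` B) * c%:E) ->
  forall g : R -> R, measurable_fun setT g -> (forall x, (0 <= g x)%R) ->
  \int[P]_w (g (X w) * G w)%:E = \int[P]_w (g (X w))%:E * c%:E.
Proof.
move=> mX mG G0 c0 hB g mg g0.
have mEg : measurable_fun [set: R] (EFin \o g) by exact/measurable_EFinP.
pose h := nnsfun_approx measurableT mEg.
have hcvg x : (h n x)%:E @[n --> \oo] --> (g x)%:E.
  by apply: (cvg_nnsfun_approx measurableT mEg) => // y _; rewrite /= lee_fin.
have hnd x : {homo (fun n => h n x) : m n / (m <= n)%N >-> (m <= n)%R}.
  by move=> m n mn; exact/lefP/nd_nnsfun_approx.
have mhX n : measurable_fun setT (fun w => (h n (X w))%:E).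
  by apply/measurable_EFinP; exact: measurableT_comp.
have mhXG n : measurable_fun setT (fun w => (h n (X w) * G w)%:E).
  by apply/measurable_EFinP; apply: measurable_funM => //; exact: measurableT_comp.
have cvgL : \int[P]_w (h n (X w) * G w)%:E @[n --> \oo] --> \int[P]_w (g (X w) * G w)%:E.
  rewrite [X in _ --> X](_ : _ = \int[P]_w limn (fun n => (h n (X w) * G w)%:E)).
    apply: cvg_monotone_convergence => //.
    - by move=> n w _; rewrite lee_fin mulr_ge0.
    - by move=> w _ m n mn; rewrite lee_fin ler_wpM2r// hnd.
  apply: eq_integral => w _; apply/esym/cvg_lim => //.
  under eq_fun do rewrite EFinM.
  by rewrite EFinM; apply: cvgeZr.
have cvgR : \int[P]_w (h n (X w))%:E @[n --> \oo] --> \int[P]_w (g (X w))%:E.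
  rewrite [X in _ --> X](_ : _ = \int[P]_w limn (fun n => (h n (X w))%:E)).
    apply: cvg_monotone_convergence => //.
    - by move=> n w _; rewrite lee_fin.
    - by move=> w _ m n mn; rewrite lee_fin hnd.
  by apply: eq_integral => w _; apply/esym/cvg_lim.
have mB n y : measurable (h n @^-1` [set y]) by [].
have simple n : \int[P]_w (h n (X w) * G w)%:E = \int[P]_w (h n (X w))%:E * c%:E.
  pose s := finmap.enum_fset (fset_set (range (h n))).
  have expand w : (h n (X w) =
      \sum_(y <- s) y * \1_(h n @^-1` [set y]) (X w))%R.
    by rewrite [LHS]fimfunE -fsbig_finite.
  have y0 y : y \in s -> (0 <= y)%R.
    by rewrite /s in_fset_set// inE => -[x _ <-].
  have mI y : measurable_fun setT (fun w => \1_(h n @^-1` [set y]) (X w) : R).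
    have mf : measurable_fun [set: R] (\1_(h n @^-1` [set y]) : R -> R).
      exact: measurable_indic.
    exact: (measurableT_comp mf mX).
  transitivity (\int[P]_w \sum_(y <- s)
      (`|y| * (\1_(h n @^-1` [set y]) (X w) * G w))%:E).
    apply: eq_integral => w _; rewrite expand mulr_suml sumEFin; congr EFin.
    by apply: eq_big_seq => y /y0 yge0; rewrite mulrA ger0_norm.
  rewrite ge0_integral_sum//; last 2 first.
  - move=> y; apply/measurable_EFinP; apply: measurable_funM => //.
    exact: measurable_funM.
  - by move=> y w _; rewrite lee_fin !mulr_ge0.
  transitivity (\sum_(y <- s)
      (`|y|%:E * P (X @^-1` (h n @^-1` [set y]))) * c%:E).
    apply: eq_bigr => y _; under eq_integral do rewrite EFinM.
    rewrite ge0_integralZl_EFin//; last 2 first.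
    - by move=> w _; rewrite lee_fin mulr_ge0.
    - by apply/measurable_EFinP; exact: measurable_funM.
    by rewrite hB// muleA.
  rewrite -ge0_sume_distrl; last by move=> y _; rewrite mule_ge0.
  congr (_ * _).
  transitivity (\int[P]_w \sum_(y <- s)
      (`|y| * \1_(h n @^-1` [set y]) (X w))%:E); last first.
    apply: eq_integral => w _; rewrite [in RHS]expand sumEFin; congr EFin.
    by apply: eq_big_seq => y /y0 yge0; rewrite ger0_norm.
  rewrite ge0_integral_sum//; last first.
    by move=> y; apply/measurable_EFinP; exact: measurable_funM.
  apply: eq_bigr => y _; under eq_integral do rewrite EFinM.
  rewrite ge0_integralZl_EFin//; last exact/measurable_EFinP.
  congr (_ * _).
  rewrite -[X in P X]setIT -integral_indic//; last by rewrite -[X in measurable X]setTI; exact: mX.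
have /cvg_lim <-// := cvgL.
by under eq_fun do rewrite simple; apply/cvg_lim => //; exact: cvgeZr.
Qed.

(** Independence is a statement about indicators; the test functions are
    replaced by arbitrary ones coordinate by coordinate. *)
Lemma expectation_prod_independent (I : finType) (X : I -> T -> R)
    (f : I -> R -> R) (e : I -> R) :
    (forall i, measurable_fun setT (X i)) -> mutually_independent P X ->
    (forall i, measurable_fun setT (f i)) -> (forall i x, (0 <= f i x)%R) ->
    (forall i, \int[P]_w (f i (X i w))%:E = (e i)%:E) ->
  \int[P]_w (\prod_i f i (X i w))%:E = (\prod_i e i)%:E.
Proof.
move=> mX ind.
suff gen (D : {set I}) (g : I -> R -> R) (a : I -> R) :
    (forall i, i \notin D -> exists2 B, measurable B & g i = \1_B) ->
    (forall i, measurable_fun setT (g i)) -> (forall i x, (0 <= g i x)%R) ->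
    (forall i, \int[P]_w (g i (X i w))%:E = (a i)%:E) ->
    \int[P]_w (\prod_i g i (X i w))%:E = (\prod_i a i)%:E.
  by apply: (gen [set: I]%SET) => i; rewrite finset.in_setT.
move: {2}#|D| (erefl #|D|) => m; elim: m D g a => [|m IH] D g a Dm gD mg g0 ga.
  have /choice[B hB] : forall i, exists B, measurable B /\ g i = \1_B.
    move=> i; have [|B mB gB] := gD i; last by exists B.
    by rewrite (cards0_eq Dm) finset.in_set0.
  have PB i : P (X i @^-1` B i) = (a i)%:E.
    rewrite -ga -[X in P X]setIT -integral_indic//; last first.
      by rewrite -[X in measurable X]setTI; apply: mX => //; case: (hB i).
    by apply: eq_integral => w _; have [_ ->] := hB i.
  transitivity (P (\bigcap_(i in [set` [set: I]%SET]) X i @^-1` B i)).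
    rewrite -[X in P X]setIT -integral_indic//; last first.
      apply: fin_bigcap_measurable => [|i _]; first exact: finite_finset.
      by rewrite -[X in measurable X]setTI; apply: mX => //; case: (hB i).
    apply: eq_integral => w _; congr EFin; rewrite indicE.
    have [wB|wB] := pselect (forall i, B i (X i w)).
      rewrite mem_set; last by move=> i _; exact: wB.
      by rewrite big1// => i _; have [_ ->] := hB i; rewrite indicE mem_set.
    rewrite memNset; last by move=> h; apply: wB => i; apply: h => /=; rewrite finset.in_setT.
    have /existsNP[i Bi] := wB.
    by rewrite (bigD1 i)//=; have [_ ->] := hB i; rewrite indicE memNset// mul0r.
  rewrite ind; last by move=> i; case: (hB i).
  transitivity (\prod_i (a i)%:E); last by rewrite prodEFin.
  by apply: eq_big => i; rewrite ?finset.in_setT.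
have [k kD] : exists k, k \in D by apply/card_gt0P; rewrite Dm.
pose G w := (\prod_(i | i != k) g i (X i w))%R.
pose c := (\prod_(i | i != k) a i)%R.
have a0 i : (0 <= a i)%R.
  by rewrite -lee_fin -ga; apply: integral_ge0 => w _; rewrite lee_fin.
have mgX i : measurable_fun setT (fun w => g i (X i w)) by exact: measurableT_comp.
have mG : measurable_fun setT G.
  rewrite /G (_ : (fun w => _) = (fun w => \prod_(i <- [seq i <- index_enum I | i != k]) g i (X i w))%R).
    exact: measurable_prod.
  by apply/funext => w; rewrite big_filter.
have step B : measurable B ->
    \int[P]_w (\1_B (X k w) * G w)%:E = P (X k @^-1` B) * c%:E.
  move=> mB.
  have mXB : measurable (X k @^-1` B) by rewrite -[X in measurable X]setTI; exact: mX.
  have mIB : measurable_fun [set: R] (\1_B : R -> R) by exact: measurable_indic.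
  have PBE : P (X k @^-1` B) = (fine (P (X k @^-1` B)))%:E.
    by rewrite fineK// fin_num_measure.
  pose g' i := if i == k then \1_B else g i.
  pose a' i := if i == k then fine (P (X k @^-1` B)) else a i.
  have := IH (D :\ k)%SET g' a'.
  have -> : \int[P]_w (\prod_i g' i (X i w))%:E = \int[P]_w (\1_B (X k w) * G w)%:E.
    apply: eq_integral => w _; rewrite (bigD1 k)//= {1}/g' eqxx; congr (_ * _)%:E.
    by apply: eq_bigr => i ik; rewrite /g' (negbTE ik).
  have -> : (\prod_i a' i)%:E = P (X k @^-1` B) * c%:E.
    rewrite (bigD1 k)//= {1}/a' eqxx EFinM -PBE; congr (_ * _%:E).
    by apply: eq_bigr => i ik; rewrite /a' (negbTE ik).
  apply.
  - by have := cardsD1 k D; rewrite Dm kD => -[].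
  - move=> i; rewrite !inE negb_and negbK /g'; case: eqVneq => /= [_ _|_ iD].
      by exists B.
    exact: gD.
  - by move=> i; rewrite /g'; case: ifP.
  - by move=> i x; rewrite /g'; case: ifP.
  - move=> i; rewrite /g' /a'; case: eqVneq => [->|//].
    by rewrite -PBE -[X in P X]setIT -integral_indic.
have G0 w : (0 <= G w)%R by apply: prodr_ge0.
have c0 : (0 <= c)%R by apply: prodr_ge0.
have := integral_weighted_comp (mX k) mG G0 c0 step (mg k) (g0 k).
rewrite ga -EFinM => H.
rewrite [in RHS](bigD1 k)//= -H; apply: eq_integral => w _.
by rewrite (bigD1 k).
Qed.

End product_expectation.

(** * Exponential moments and the tail of a linear form *)

Section bernstein.
Context {R : realType}.

Lemma expR_partial_sums (t : R) :
  1 + t + \sum_(0 <= k < n) t ^+ k.+2 / k.+2`!%:R @[n --> \oo] --> expR t.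
Proof.
have /cvg_ex[/= l hl] := @is_cvg_series_exp_coeff R t.
have -> : expR t = l by apply/cvg_lim.
rewrite (_ : (fun n => _) = (fun n => series (exp_coeff t) (n + 2)%N)).
  by rewrite (cvg_shiftn 2).
apply/funext => n; rewrite /series/= addn2 big_nat_recl// big_nat_recl//= /exp_coeff/=.
by rewrite !fact0 expr0 expr1 !divr1 addrA.
Qed.

Lemma expR_sub_id_series (t : R) :
  1 + \sum_(0 <= k < n) t ^+ k.+2 / k.+2`!%:R @[n --> \oo] --> expR t - t.
Proof.
rewrite (_ : (fun n => _) =
    (fun n => 1 + t + \sum_(0 <= k < n) t ^+ k.+2 / k.+2`!%:R - t)).
  by apply: cvgB; [exact: expR_partial_sums|exact: cvg_cst].
by apply/funext => n /=; rewrite [RHS]addrAC addrK.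
Qed.

(** The two series share their constant term and have no term of degree 1; the
    remaining terms are compared one by one. *)
Lemma expR_sub_id_le (y : R) : expR y - y <= expR `|y| - `|y|.
Proof.
have h1 := @expR_sub_id_series y; have h2 := @expR_sub_id_series `|y|.
apply: (ler_cvg_to h1 h2); apply: nearW => n; rewrite lerD2l.
apply: ler_sum => k _; rewrite ler_wpM2r ?invr_ge0 ?ler0n//.
by rewrite -normrX ler_norm.
Qed.

Section moment_generating.
Context d (T : measurableType d) (P : probability T R).
Variables (Z : T -> R) (s2 c : R).
Hypotheses (mZ : measurable_fun setT Z) (s20 : 0 <= s2) (c0 : 0 <= c).
Hypothesis iZ : P.-integrable setT (EFin \o Z).
Hypothesis meanZ : (\int[P]_w (Z w)%:E = 0)%E.
Hypothesis momZ : forall k, (\int[P]_w (`|Z w| ^+ k.+2)%:E <=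
  (k.+2`!%:R / 2 * c ^+ k * s2)%:E)%E.

(** The mean being zero removes the linear term of the exponential; the others
    are bounded by a geometric series of ratio [|l| c]. Its sum is at most 20/19,
    and 53/100 exceeds 10/19; the Gaussian value would be 1/2. *)
Lemma bernstein_mgf (l : R) : `|l| * c <= 20^-1 ->
  (\int[P]_w (expR (l * Z w))%:E <= (expR (53 / 100 * l ^+ 2 * s2))%:E)%E.
Proof.
move=> lc.
pose h (t : R) := expR t - t - 1.
have mlZ : measurable_fun setT (fun w => l * Z w) by exact: measurable_funM.
have mnlZ : measurable_fun setT (fun w => `|l * Z w|).
  by apply: measurableT_comp mlZ.
have mh : measurable_fun setT (fun w => h `|l * Z w|).
  apply: measurable_funB; last exact: measurable_cst.
  by apply: measurable_funB => //; exact: measurableT_comp.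
have h0 t : 0 <= t -> 0 <= h t.
  by move=> t0; rewrite /h subr_ge0 lerBrDr expR_ge1Dx.
have hser t : 0 <= t ->
    ((h t)%:E = \sum_(k <oo) (t ^+ k.+2 / k.+2`!%:R)%:E)%E.
  move=> t0; apply/esym/cvg_lim => //.
  under eq_fun do rewrite sumEFin.
  have hc : \sum_(0 <= k < n) t ^+ k.+2 / k.+2`!%:R @[n --> \oo] --> h t.
    rewrite (_ : (fun n => _) =
        (fun n => 1 + \sum_(0 <= k < n) t ^+ k.+2 / k.+2`!%:R - 1)).
      by apply: cvgB; [exact: expR_sub_id_series|exact: cvg_cst].
    by apply/funext => n /=; rewrite [RHS]addrAC subrr add0r.
  by apply: cvg_EFin; [exact: nearW|exact: hc].
have Eh : (\int[P]_w (h `|l * Z w|)%:E <= (53 / 100 * l ^+ 2 * s2)%:E)%E.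
  under eq_integral do rewrite hser//.
  rewrite integral_nneseries//; last first.
    move=> k; apply/measurable_EFinP; apply: measurable_funM; last exact: measurable_cst.
    exact: measurable_funX.
  apply: lime_le; first by apply: is_cvg_nneseries => k _ _; apply: integral_ge0 => w _;
    rewrite lee_fin divr_ge0 ?exprn_ge0.
  apply: nearW => n.
  apply: (@le_trans _ _ (\sum_(0 <= k < n) ((l ^+ 2 * s2 / 2) * (`|l| * c) ^+ k)%:E)%E).
    apply: lee_sum => k _.
    have -> : (\int[P]_w (`|l * Z w| ^+ k.+2 / k.+2`!%:R)%:E =
        (`|l| ^+ k.+2 / k.+2`!%:R)%:E * \int[P]_w (`|Z w| ^+ k.+2)%:E)%E.
      rewrite -ge0_integralZl_EFin//; last first.
        by apply/measurable_EFinP; apply: measurable_funX; exact: measurableT_comp.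
      by apply: eq_integral => w _; rewrite -EFinM normrM exprMn mulrAC.
    have a0 : 0 <= `|l| ^+ k.+2 / k.+2`!%:R by rewrite divr_ge0 ?exprn_ge0.
    apply: le_trans (lee_wpmul2l _ (momZ k)) _; first by rewrite lee_fin.
    rewrite -EFinM lee_fin.
    have -> : `|l| ^+ k.+2 = l ^+ 2 * `|l| ^+ k.
      by rewrite -addn2 exprD mulrC -normrX ger0_norm ?sqr_ge0.
    rewrite exprMn le_eqVlt; apply/orP; left; apply/eqP; field.
    by rewrite pnatr_eq0 -lt0n fact_gt0.
  rewrite sumEFin lee_fin -mulr_sumr.
  have lc0 : 0 <= `|l| * c by exact: mulr_ge0.
  have geo : \sum_(0 <= k < n) (`|l| * c) ^+ k <= 20 / 19.
    set q := `|l| * c in lc lc0 *.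
    have E : (1 - q) * \sum_(0 <= k < n) q ^+ k = 1 - q ^+ n.
      elim: n => [|n IH]; first by rewrite big_geq// mulr0 expr0 subrr.
      by rewrite big_nat_recr//= mulrDr IH exprS; ring.
    have qn : 0 <= q ^+ n by exact: exprn_ge0.
    have S0 : 0 <= \sum_(0 <= k < n) q ^+ k by apply: sumr_ge0 => k _; exact: exprn_ge0.
    have : 19 / 20 * \sum_(0 <= k < n) q ^+ k <= (1 - q) * \sum_(0 <= k < n) q ^+ k.
      by rewrite ler_wpM2r//; lra.
    by rewrite E; lra.
  have ls0 : 0 <= l ^+ 2 * s2 by rewrite mulr_ge0 ?sqr_ge0.
  apply: (@le_trans _ _ (l ^+ 2 * s2 / 2 * (20 / 19))); first by rewrite ler_wpM2l ?divr_ge0.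
  by rewrite -mulrA; lra.
have ih : P.-integrable setT (fun w => (h `|l * Z w|)%:E).
  apply/integrableP; split; first exact/measurable_EFinP.
  under eq_integral do rewrite gee0_abs ?lee_fin ?h0//.
  exact: le_lt_trans Eh (ltry _).
have ilZ : P.-integrable setT (fun w => (l * Z w)%:E).
  rewrite (_ : (fun w => _) = (fun w => l%:E * (Z w)%:E)%E); last by apply/funext.
  exact: integrableZl.
have i1 : P.-integrable setT (fun w => 1%:E + (l * Z w)%:E)%E.
  by apply: integrableD => //; exact: finite_measure_integrable_cst.
apply: (@le_trans _ _ (\int[P]_w (1%:E + (l * Z w)%:E + (h `|l * Z w|)%:E))%E).
  apply: ge0_le_integral => //.
  - by apply/measurable_EFinP; exact: measurableT_comp.
  - apply/measurable_EFinP; apply: measurable_funD => //.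
    by apply: measurable_funD => //; exact: measurable_cst.
  - by move=> w _; rewrite lee_fin /h; have := expR_sub_id_le (l * Z w); lra.
rewrite integralD//.
rewrite integralD//; last exact: finite_measure_integrable_cst.
rewrite integral_cst// [X in (_ * X)%E]probability_setT mule1.
under [X in (_ + X + _)%E]eq_integral do rewrite EFinM.
rewrite integralZl// meanZ mule0 adde0.
apply: le_trans (leeD2l _ Eh) _; rewrite -EFinD lee_fin.
exact: expR_ge1Dx.
Qed.
End moment_generating.
End bernstein.

Section linear_form.
Context d (T : measurableType d) (R : realType) (P : probability T R).

Lemma linear_form_tail (I : finType) (X : I -> T -> R) (a : I -> R)
    (m s2 c l t V : R) :
    (forall i, measurable_fun setT (X i)) -> mutually_independent P X ->
    0 <= s2 -> 0 <= c -> 0 <= l ->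
    (forall i, P.-integrable setT (fun w => (X i w - m)%:E)) ->
    (forall i, \int[P]_w (X i w - m)%:E = 0)%E ->
    (forall i k, \int[P]_w (`|X i w - m| ^+ k.+2)%:E <=
       (k.+2`!%:R / 2 * c ^+ k * s2)%:E)%E ->
    (forall i, `|l * a i| * c <= 20^-1) -> \sum_i a i ^+ 2 <= V ->
  (P [set w | (t <= \sum_i a i * (X i w - m))%R] <=
    (expR (- (l * t) + 53 / 100 * l ^+ 2 * s2 * V))%:E)%E.
Proof.
move=> mX ind s20 c0 l0 iX EX momX lac aV.
pose f i (x : R) := expR (l * a i * (x - m)).
have mf i : measurable_fun [set: R] (f i).
  apply: measurableT_comp => //; apply: measurable_funM; first exact: measurable_cst.
  by apply: measurable_funB => //; exact: measurable_cst.
have mZ i : measurable_fun setT (fun w => X i w - m).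
  by apply: measurable_funB => //; exact: measurable_cst.
have fle i : (\int[P]_w (f i (X i w))%:E <=
    (expR (53 / 100 * (l * a i) ^+ 2 * s2))%:E)%E.
  exact: (bernstein_mgf (mZ i) s20 c0 (iX i) (EX i) (momX i) (lac i)).
have f0 i w : 0 <= f i w by exact: expR_ge0.
have fE i : (\int[P]_w (f i (X i w))%:E =
    (fine (\int[P]_w (f i (X i w))%:E))%:E)%E.
  rewrite fineK// ge0_fin_numE ?(le_lt_trans (fle i) (ltry _))//.
  by apply: integral_ge0 => w _; rewrite lee_fin.
have prodE := expectation_prod_independent mX ind mf f0 fE.
pose S w := \sum_i a i * (X i w - m).
have mS : measurable_fun setT S.
  apply: measurable_sum => i.
  by apply: measurable_funM; [exact: measurable_cst|exact: mZ].
have mA : measurable [set w | t <= S w].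
  rewrite (_ : [set w | t <= S w] = S @^-1` `[t, +oo[); last first.
    by apply/seteqP; split => w /=; rewrite in_itv/= andbT.
  by rewrite -[X in measurable X]setTI; exact: mS.
have prodS w : \prod_i f i (X i w) = expR (l * S w).
  by rewrite -expR_sum mulr_sumr; congr expR; apply: eq_bigr => i _; rewrite mulrA.
apply: (@le_trans _ _ ((expR (- (l * t)))%:E * \int[P]_w (\prod_i f i (X i w))%:E)%E).
  rewrite -[X in P X]setIT -integral_indic//.
  have mprod : measurable_fun setT (fun w => (\prod_i f i (X i w))%:E).
    under eq_fun do rewrite prodS.
    apply/measurable_EFinP; apply: measurableT_comp => //.
    by apply: measurable_funM => //; exact: measurable_cst.
  rewrite -ge0_integralZl_EFin ?expR_ge0//; last first.
    by move=> w _; rewrite lee_fin prodS expR_ge0.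
  apply: ge0_le_integral => //.
  - exact/measurable_EFinP/measurable_indic.
  - by apply: emeasurable_funM => //; exact/measurable_EFinP.
  - move=> w _; rewrite prodS -EFinM lee_fin -expRD indicE.
    have [|] := boolP (w \in _); rewrite ?expR_ge0// inE /= => tS.
    by rewrite -[leLHS]expR0 ler_expR addrC subr_ge0 ler_wpM2l.
rewrite prodE -EFinM lee_fin expRD ler_wpM2l ?expR_ge0//.
apply: (@le_trans _ _ (\prod_i expR (53 / 100 * (l * a i) ^+ 2 * s2))).
  apply: ler_prod => i _; rewrite -!lee_fin -fE fle andbT.
  by apply: integral_ge0 => w _; rewrite lee_fin.
rewrite -expR_sum ler_expR.
have -> : \sum_i 53 / 100 * (l * a i) ^+ 2 * s2 =
    53 / 100 * l ^+ 2 * s2 * \sum_i a i ^+ 2.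
  by rewrite mulr_sumr; apply: eq_bigr => i _; rewrite exprMn; ring.
by rewrite ler_wpM2l// !mulr_ge0// sqr_ge0.
Qed.

End linear_form.

(** * Linear forms in the entries of a random matrix *)

Section transfer_of_law.
Context d (T : measurableType d) (R : realType) (P : probability T R).
Variables (X : T -> R) (F : probability R R).
Hypotheses (mX : measurable_fun setT X) (XF : has_law P X F).
Local Open Scope ereal_scope.

Lemma ge0_integral_has_law (g : R -> R) :
    measurable_fun setT g -> (forall x, (0 <= g x)%R) ->
  \int[P]_w (g (X w))%:E = \int[F]_x (g x)%:E.
Proof.
move=> mg g0.
have mEg : measurable_fun [set: R] (EFin \o g) by exact/measurable_EFinP.
have := ge0_integral_pushforward mX P measurableT mEg.
rewrite preimage_setT => <-; last by move=> x _; rewrite /= lee_fin.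
by apply: eq_measure_integral => B mB _; exact: XF.
Qed.

Lemma integrable_has_law (g : R -> R) : measurable_fun setT g ->
  F.-integrable setT (EFin \o g) -> P.-integrable setT (fun w => (g (X w))%:E).
Proof.
move=> mg /integrableP[_ ig].
have mgX : measurable_fun setT (fun w => g (X w)) by exact: measurableT_comp.
apply/integrableP; split; first exact/measurable_EFinP.
under eq_integral do rewrite abse_EFin.
rewrite (@ge0_integral_has_law (fun x => `|g x|%R))//.
exact: measurableT_comp.
Qed.

Lemma integral_has_law (g : R -> R) : measurable_fun setT g ->
    F.-integrable setT (EFin \o g) ->
  \int[P]_w (g (X w))%:E = \int[F]_x (g x)%:E.
Proof.
move=> mg ig.
have mEg : measurable_fun [set: R] (EFin \o g) by exact/measurable_EFinP.
have igX := integrable_has_law mg ig.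
have := integral_pushforward mX (mu := P) (D := setT) mEg.
rewrite preimage_setT => /(_ igX measurableT) <-.
by apply: eq_measure_integral => B mB _; exact: XF.
Qed.

End transfer_of_law.

Section bernstein_law.
Context {R : realType}.

(** The index [k] counts from the second moment, so that the case [k = 0] is the
    variance and all moments obey one formula. *)
Definition bernstein_law (F : probability R R) (m s2 c : R) : Prop :=
  [/\ F.-integrable setT (fun x => (x - m)%:E),
      (\int[F]_x (x - m)%:E = 0)%E
    & forall k, (\int[F]_x (`|x - m| ^+ k.+2)%:E <=
         (k.+2`!%:R / 2 * c ^+ k * s2)%:E)%E].

Lemma bernstein_law_of_moments (F : probability R R) (c : R) :
    finite_mean_var F ->
    (forall k, (3 <= k)%N -> (\int[F]_x (`|x - dist_mean F| ^+ k)%:E <=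
       (k`!%:R / 2 * c ^+ (k - 2) * dist_std F ^+ 2)%:E)%E) ->
  bernstein_law F (dist_mean F) (dist_std F ^+ 2) (`|c| + 1).
Proof.
move=> [iF vF] hk.
have meanE : (\int[F]_x x%:E = (dist_mean F)%:E)%E.
  rewrite /dist_mean unlock /= fineK//; exact: integrable_fin_num.
have icst : F.-integrable setT (fun x : R => (dist_mean F)%:E).
  exact: finite_measure_integrable_cst.
have s2E : dist_std F ^+ 2 = fine 'V_F[idfun].
  by rewrite /dist_std sqr_sqrtr// fine_ge0// variance_ge0.
split.
- rewrite (_ : (fun x => _) = (fun x : R => x%:E - (dist_mean F)%:E)%E)//.
  exact: integrableB.
- under eq_integral do rewrite EFinB.
  rewrite integralB// meanE integral_cst// [X in (_ - _ * X)%E]probability_setT mule1.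
  by rewrite subee.
- move=> [|k].
    rewrite expr0 mulr1 -[X in X%:R]/2%N divff ?pnatr_eq0// mul1r s2E fineK; last first.
      by rewrite ge0_fin_numE// variance_ge0.
    rewrite /variance covariance.unlock -/(dist_mean F) unlock.
    rewrite le_eqVlt; apply/orP; left; apply/eqP; apply: eq_integral => x _.
    by rewrite -normrX ger0_norm ?sqr_ge0// expr2.
  apply: le_trans (hk k.+3 isT) _; rewrite lee_fin subSS subSS subn0.
  rewrite ler_wpM2r ?sqr_ge0// ler_wpM2l ?divr_ge0//.
  rewrite (le_trans (ler_norm _))// normrX lerXn2r ?nnegrE ?addr_ge0//.
  by rewrite lerDl.
Qed.

End bernstein_law.

Section iid_matrix.
Context {R : realType}.

Lemma measurable_entry n (i j : 'I_n) :
  measurable_fun [set: rmatrix R n] (fun M : rmatrix R n => (M : 'M[R]_n) i j).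
Proof.
move=> _ B mB; rewrite setTI.
by apply: sub_sigma_algebra; exists i, j, B.
Qed.

Definition linear_form n (m : R) (g : 'I_n -> 'I_n -> R) (M : 'M[R]_n) : R :=
  \sum_j \sum_k g j k * centred m M j k.

Lemma sum_upper_pair n (h : 'I_n -> 'I_n -> R) :
  \sum_(e : upper_pair n) (h (val e).1 (val e).2 + h (val e).2 (val e).1) =
  \sum_j \sum_(k | k != j) h j k.
Proof.
pose H (ij : 'I_n * 'I_n) := h ij.1 ij.2 + h ij.2 ij.1.
rewrite -(big_sub [pred ij : 'I_n * 'I_n | (ij.1 < ij.2)%N] H)/=.
have -> : \sum_(ij : 'I_n * 'I_n | (ij.1 < ij.2)%N) H ij =
    \sum_(j < n) \sum_(k < n | (j < k)%N) h j k +
    \sum_(j < n) \sum_(k < n | (k < j)%N) h j k.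
  rewrite big_split/= (pair_big_dep xpredT (fun j k : 'I_n => (j < k)%N))/=.
  congr (_ + _); rewrite (exchange_big_dep xpredT)//=.
  by rewrite (pair_big_dep xpredT (fun j k : 'I_n => (j < k)%N))/=.
rewrite -big_split/=; apply: eq_bigr => j _.
rewrite [RHS](bigID (fun k : 'I_n => (j < k)%N))/=; congr (_ + _); apply: eq_bigl => k.
  by rewrite -val_eqE/=; case: ltngtP.
by rewrite -val_eqE/=; case: ltngtP.
Qed.

(** Pairing each position with its mirror image turns the form into one in the
    independent entries above the diagonal. *)
Lemma linear_formE n m g (M : 'M[R]_n) : M^T = M ->
  linear_form m g M = \sum_(e : upper_pair n)
    (g (val e).1 (val e).2 + g (val e).2 (val e).1) * (M (val e).1 (val e).2 - m).
Proof.
move=> MT.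
have MC j k : M j k = M k j by rewrite -[in LHS]MT mxE.
transitivity (\sum_j \sum_(k | k != j) g j k * (M j k - m)).
  apply: eq_bigr => j _; rewrite [RHS]big_mkcond/=; apply: eq_bigr => k _.
  by rewrite /centred eq_sym; case: eqP => _ /=; rewrite ?mulr0.
rewrite -sum_upper_pair; apply: eq_bigr => e _.
by rewrite mulrDl (MC (val e).2).
Qed.

(** The variance of a linear form is at most twice the sum of its squared
    coefficients, the factor 2 accounting for the symmetry of the matrix. *)
Lemma linear_form_square_le n (g : 'I_n -> 'I_n -> R) :
  \sum_(e : upper_pair n) (g (val e).1 (val e).2 + g (val e).2 (val e).1) ^+ 2 <=
  2 * \sum_j \sum_(k | k != j) g j k ^+ 2.
Proof.
rewrite -sum_upper_pair mulr_sumr; apply: ler_sum => e _.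
move: (g _ _) (g _ _) => x y; have := sqr_ge0 (x - y).
by rewrite sqrrB sqrrD; lra.
Qed.

Context d (T : measurableType d) (P : probability T R) (n : nat).
Variables (A : {RV P >-> rmatrix R n}) (F : probability R R) (m s2 c : R).
Hypotheses (hA : symmetric_iid_entries P A F) (hF : bernstein_law F m s2 c).
Hypotheses (s20 : 0 <= s2) (c0 : 0 <= c).

Let mA i j : measurable_fun setT (fun w => (A w : 'M[R]_n) i j).
Proof. exact: (measurableT_comp (@measurable_entry n i j)). Qed.

Lemma linear_form_tail_iid g (l t V : R) : 0 <= l ->
    (forall j k, `|g j k| <= 1) -> l * 2 * c <= 20^-1 ->
    \sum_(e : upper_pair n) (g (val e).1 (val e).2 + g (val e).2 (val e).1) ^+ 2 <= V ->
  (P [set w | (t <= linear_form m g (A w))%R] <=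
   (expR (- (l * t) + 53 / 100 * l ^+ 2 * s2 * V))%:E)%E.
Proof.
move=> l0 g1 l2c gV; have [symA diagA lawA indA] := hA; have [iF mF kF] := hF.
pose X (e : upper_pair n) w := (A w : 'M[R]_n) (val e).1 (val e).2.
have mX e : measurable_fun setT (X e) by exact: mA.
have XF e : has_law P (X e) F by apply: lawA; exact: (valP e).
have mc : measurable_fun [set: R] (fun x => x - m).
  by apply: measurable_funB => //; exact: measurable_cst.
pose a (e : upper_pair n) := g (val e).1 (val e).2 + g (val e).2 (val e).1.
rewrite (_ : [set w | _] = [set w | t <= \sum_e a e * (X e w - m)]); last first.
  by apply/seteqP; split => w /=; rewrite linear_formE.
apply: (linear_form_tail (a := a) _ mX indA s20 c0 l0) => //.
- by move=> e; exact: (integrable_has_law (mX e) (XF e) mc iF).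
- by move=> e; rewrite (integral_has_law (mX e) (XF e) mc iF).
- move=> e k; rewrite (ge0_integral_has_law (mX e) (XF e) (g := fun x => `|x - m| ^+ k.+2)) //.
  by apply: measurable_funX; exact: measurableT_comp.
- move=> e; apply: le_trans l2c; rewrite ler_wpM2r// normrM ger0_norm//.
  rewrite ler_wpM2l// (le_trans (ler_normD _ _))// -[2]natr1.
  by rewrite lerD.
Qed.

End iid_matrix.

(** * The exceptional set of matrices *)

Section union_bound.
Context d (T : measurableType d) (R : realType) (P : probability T R).

Lemma union_bound (I : finType) (Q : pred I) (S : I -> set T) (e : R) : 0 <= e ->
    (forall i, Q i -> measurable (S i)) ->
    (forall i, Q i -> (P (S i) <= e%:E)%E) ->
  (P (\big[setU/set0]_(i | Q i) S i) <= (#|I|%:R * e)%:E)%E.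
Proof.
move=> e0 mS Se; have -> : #|I| = size (index_enum I) by rewrite /index_enum -enumT -cardE.
elim: (index_enum I) => [|i r IH]; first by rewrite big_nil measure0 /= mul0r.
rewrite big_cons /= -natr1 mulrDl mul1r EFinD.
case: ifPn => Qi; last by apply: (le_trans IH); rewrite leeDl// lee_fin.
apply: le_trans (measureU2 _ _ _) _; [exact: mS| exact: bigsetU_measurable|].
by rewrite addeC; apply: leeD => //; exact: Se.
Qed.

End union_bound.

Section bad_matrix.
Context {R : realType}.
Variables (n : nat) (m tD tL delta C : R).

Let N : R := n.-1%:R * m.

(** The sign [b] allows upper and lower deviations of a row sum to be treated as
    upper deviations of two forms. *)
Definition row_form (i : 'I_n) (b : bool) (j k : 'I_n) : R :=
  (-1) ^+ b * (j == i)%:R.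

Definition entry_form (i i' j k : 'I_n) : R := ((j == i) && (k == i'))%:R.

Definition cut_form (T S : {set 'I_n}) (j k : 'I_n) : R :=
  (j \in T)%:R * (if k \in S then 1 else -1).

Definition exceeds (t : R) (g : 'I_n -> 'I_n -> R) : set (rmatrix R n) :=
  [set M : rmatrix R n | t <= linear_form m g M].

Definition ill_formed (i j : 'I_n) : set (rmatrix R n) :=
  [set M | (M : 'M[R]_n) i j - (M : 'M[R]_n) j i != 0] `|`
  ([set M | (M : 'M[R]_n) i i != 0] `|` [set M | (M : 'M[R]_n) i j < 0]).

(** The matrices that are not symmetric with zero diagonal and nonnegative
    entries, or that violate one of the three kinds of deviation bounds. *)
Definition bad_matrix : set (rmatrix R n) :=
  (\big[setU/set0]_(ij : 'I_n * 'I_n) ill_formed ij.1 ij.2) `|`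
  ((\big[setU/set0]_(ib : 'I_n * bool) exceeds tD (row_form ib.1 ib.2)) `|`
  ((\big[setU/set0]_(ij : 'I_n * 'I_n) exceeds tL (entry_form ij.1 ij.2)) `|`
  (\big[setU/set0]_(TS : {set 'I_n} * {set 'I_n} | C <= #|TS.1|%:R * m)
     exceeds (delta * N * #|TS.1|%:R) (cut_form TS.1 TS.2)))).

Lemma measurable_exceeds t g : measurable (exceeds t g).
Proof.
have mL : measurable_fun [set: rmatrix R n] (fun M => linear_form m g (M : 'M[R]_n)).
  apply: measurable_sum => j; apply: measurable_sum => k.
  apply: measurable_funM; first exact: measurable_cst.
  rewrite /centred; have [_|_] := eqVneq j k; first exact: measurable_cst.
  by apply: measurable_funB; [exact: measurable_entry|exact: measurable_cst].
rewrite (_ : exceeds t g =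
    (fun M : rmatrix R n => linear_form m g (M : 'M[R]_n)) @^-1` `[t, +oo[).
  by rewrite -[X in measurable X]setTI; exact: mL.
by apply/seteqP; split => M /=; rewrite in_itv/= andbT.
Qed.

Lemma measurable_ill_formed i j : measurable (ill_formed i j).
Proof.
have pre (f : rmatrix R n -> R) (B : set R) : measurable_fun setT f -> measurable B ->
    measurable [set M | B (f M)].
  by move=> mf mB; rewrite -[X in measurable X]setTI; exact: mf.
have mn0 : measurable [set x : R | x != 0].
  rewrite (_ : [set x : R | x != 0] = [set~ 0]); first exact: measurableC.
  by apply/seteqP; split => x /= /eqP.
have mlt0 : measurable [set x : R | x < 0].
  rewrite (_ : [set x : R | x < 0] = `]-oo, 0[%classic).
    exact: measurable_itv.
  by apply/seteqP; split => x /=; rewrite in_itv.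
have me k l := @measurable_entry R n k l.
apply: measurableU; last apply: measurableU.
- exact: (pre _ _ (measurable_funB (me i j) (me j i)) mn0).
- exact: (pre _ _ (me i i) mn0).
- exact: (pre _ _ (me i j) mlt0).
Qed.

Lemma measurable_bad_matrix : measurable bad_matrix.
Proof.
do !apply: measurableU; apply: bigsetU_measurable => i _;
  by [exact: measurable_exceeds|exact: measurable_ill_formed].
Qed.

Section probability.
Context d (T : measurableType d) (P : probability T R).
Variables (A : {RV P >-> rmatrix R n}) (F : probability R R) (s2 c : R).
Hypotheses (hA : symmetric_iid_entries P A F) (hF : bernstein_law F m s2 c).
Hypotheses (F0 : nonneg_dist F) (s20 : 0 <= s2) (c0 : 0 <= c).

Let Q : probability (rmatrix R n) R := distribution P A.

Lemma ill_formed_null i j : Q (ill_formed i j) = 0.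
Proof.
have [symA diagA lawA _] := hA.
have A01 w k l : (A w : 'M[R]_n) k l = (A w : 'M[R]_n) l k.
  by have := symA w => /matrixP/(_ l k); rewrite mxE.
have neg (k l : 'I_n) : (k < l)%N -> P [set w | (A w : 'M[R]_n) k l < 0] = 0.
  move=> kl; have mneg : measurable [set x : R | x < 0].
    rewrite (_ : [set x : R | x < 0] = `]-oo, 0[%classic).
      exact: measurable_itv.
    by apply/seteqP; split => x /=; rewrite in_itv.
  by have := lawA k l kl _ mneg; rewrite F0.
have -> : Q (ill_formed i j) = P [set w | (A w : 'M[R]_n) i j < 0].
  congr (P _); apply/seteqP; split => w /=; last by right; right.
  case=> [|[|//]]; first by rewrite /= (A01 w i j) subrr eqxx.
  by rewrite /= diagA eqxx.
have [ij|ji|/val_inj ->] := ltngtP i j; first exact: neg.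
  by rewrite -(neg _ _ ji); congr (P _); apply/funext => w /=; rewrite A01.
rewrite (_ : [set w | _] = set0) ?measure0//.
by apply/seteqP; split => w //=; rewrite diagA ltxx.
Qed.

Variables (lD lL lC eC : R).
Hypotheses (lD0 : 0 <= lD) (lL0 : 0 <= lL) (lC0 : 0 <= lC).
Hypotheses (lDc : lD * 2 * c <= 20^-1) (lLc : lL * 2 * c <= 20^-1).
Hypotheses (lCc : lC * 2 * c <= 20^-1).
Hypothesis eC0 : 0 <= eC.
Hypothesis heC : forall k : nat, C <= k%:R * m ->
  expR (- (lC * (delta * N * k%:R)) +
        53 / 100 * lC ^+ 2 * s2 * (2 * (n.-1%:R * k%:R))) <= eC.

Let card_other (i : 'I_n) : \sum_(k | k != i) 1 = n.-1%:R :> R.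
Proof. by rewrite sumr_const cardC1 card_ord. Qed.

(** Two entries of one row are never mirror images, so the factor 2 of
    linear_form_square_le is not lost for row sums, where it would double the
    variance. *)
Let row_square_le i b : \sum_(e : upper_pair n) (row_form i b (val e).1 (val e).2 +
     row_form i b (val e).2 (val e).1) ^+ 2 <= n.-1%:R.
Proof.
have -> : n.-1%:R = \sum_j \sum_(k | k != j) (j == i)%:R :> R.
  rewrite (bigD1 i)//= [X in _ + X]big1 ?addr0; last first.
    by move=> j ji; rewrite big1// => k _; rewrite (negbTE ji).
  by rewrite -(card_other i); apply: eq_bigr => k _; rewrite eqxx.
rewrite -sum_upper_pair; apply: ler_sum => e _.
rewrite /row_form -mulrDr exprMn sqrr_sign mul1r; have := valP e.
case: eqVneq => [->|_] /=; case: eqVneq => [->|_] /=; rewrite ?ltnn// => _;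
  by rewrite ?addr0 ?add0r ?expr1n ?expr0n.
Qed.

Let prob_exceeds g l t V : 0 <= l -> l * 2 * c <= 20^-1 ->
    (forall j k, `|g j k| <= 1) ->
    \sum_(e : upper_pair n) (g (val e).1 (val e).2 + g (val e).2 (val e).1) ^+ 2 <= V ->
  (Q (exceeds t g) <= (expR (- (l * t) + 53 / 100 * l ^+ 2 * s2 * V))%:E)%E.
Proof. by move=> l0 lc g1 gV; exact: (linear_form_tail_iid hA hF s20 c0 t l0 g1 lc gV). Qed.

(** Of the four events the first is null; there are [2 n] signed rows, [n^2]
    entries, and [4^n] pairs of a set and a sign pattern. *)
Lemma bad_matrix_prob :
  (Q bad_matrix <= (
     n%:R * expR (- (lD * tD) + 53 / 100 * lD ^+ 2 * s2 * n.-1%:R) * 2 +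
     n%:R ^+ 2 * expR (- (lL * tL) + 53 / 100 * lL ^+ 2 * s2 * 2) +
     4 ^+ n * eC)%:E)%E.
Proof.
have mU (I : finType) (D : pred I) (S : I -> set (rmatrix R n)) :
    (forall i, measurable (S i)) -> measurable (\big[setU/set0]_(i | D i) S i).
  by move=> mS; exact: bigsetU_measurable.
have mE t g := measurable_exceeds t g.
have mI i j := measurable_ill_formed i j.
have Q1 : (Q (\big[setU/set0]_(ij : 'I_n * 'I_n) ill_formed ij.1 ij.2) <= 0%:E)%E.
  have := @union_bound _ _ _ Q _ xpredT (fun ij : 'I_n * 'I_n => ill_formed ij.1 ij.2) 0 (lexx _).
  by rewrite mulr0; apply => // ij _; rewrite ill_formed_null.
have Q2 : (Q (\big[setU/set0]_(ib : 'I_n * bool) exceeds tD (row_form ib.1 ib.2)) <=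
    (n%:R * expR (- (lD * tD) + 53 / 100 * lD ^+ 2 * s2 * n.-1%:R) * 2)%:E)%E.
  rewrite mulrAC -natrM; have -> : (n * 2)%N = #|{: 'I_n * bool}|.
    by rewrite card_prod card_ord card_bool.
  apply: union_bound; rewrite ?expR_ge0// => -[i b] _ /=.
  apply: (prob_exceeds tD lD0 lDc _ (row_square_le i b)).
  move=> j k; rewrite /row_form normrM normr_sign mul1r.
  by case: (j == i); rewrite ?normr1 ?normr0.
have Q3 : (Q (\big[setU/set0]_(ij : 'I_n * 'I_n) exceeds tL (entry_form ij.1 ij.2)) <=
    (n%:R ^+ 2 * expR (- (lL * tL) + 53 / 100 * lL ^+ 2 * s2 * 2))%:E)%E.
  rewrite expr2 -natrM; have -> : (n * n)%N = #|{: 'I_n * 'I_n}|.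
    by rewrite card_prod card_ord.
  apply: union_bound; rewrite ?expR_ge0// => -[i i'] _ /=.
  apply: prob_exceeds => //.
    by move=> j k; rewrite /entry_form; case: (_ && _); rewrite ?normr1 ?normr0.
  apply: le_trans (linear_form_square_le _) _; rewrite ler_piMr//.
  rewrite (bigD1 i)//= [X in _ + X]big1 ?addr0; last first.
    move=> j ji; rewrite big1// => k _.
    by rewrite /entry_form (negbTE ji) expr0n.
  apply: (@le_trans _ _ (\sum_k entry_form i i' i k ^+ 2)).
    by rewrite big_mkcond/=; apply: ler_sum => k _; case: ifP => // _; rewrite sqr_ge0.
  rewrite (bigD1 i')//= big1 ?addr0.
    by rewrite /entry_form !eqxx expr1n.
  by move=> k ki; rewrite /entry_form (negbTE ki) andbF expr0n.
have Q4 : (Q (\big[setU/set0]_(TS : {set 'I_n} * {set 'I_n} | (C <= #|TS.1|%:R * m)%R)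
      exceeds (delta * N * #|TS.1|%:R) (cut_form TS.1 TS.2)) <= (4 ^+ n * eC)%:E)%E.
  have -> : 4 ^+ n = #|{: {set 'I_n} * {set 'I_n}}|%:R :> R.
    rewrite card_prod -!cardsT -powersetT card_powerset cardsT card_ord.
    by rewrite -expnMn natrX.
  apply: union_bound => [//|[T1 S1] /= hT1|[T1 S1] /= hT1].
    exact: measurable_exceeds.
  apply: le_trans (prob_exceeds (V := 2 * (n.-1%:R * #|T1|%:R)) _ lC0 lCc _ _) _.
  - move=> j k; rewrite /cut_form normrM.
    by case: (j \in T1); case: (k \in S1); rewrite ?normr1 ?normr0 ?normrN1 ?mul0r ?mulr1.
  - apply: le_trans (linear_form_square_le _) _; rewrite ler_wpM2l//.
    have -> : \sum_j \sum_(k | k != j) cut_form T1 S1 j k ^+ 2 =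
        \sum_j (j \in T1)%:R * \sum_(k | k != j) 1 :> R.
      apply: eq_bigr => j _; rewrite mulr_sumr; apply: eq_bigr => k _.
      rewrite /cut_form mulr1; case: (j \in T1); case: (k \in S1);
        by rewrite ?mul1r ?mul0r ?sqrrN ?expr1n ?expr0n.
    under eq_bigr do rewrite card_other.
    rewrite -mulr_suml mulrC ler_wpM2l// -natr_sum ler_nat -sum1_card.
    by rewrite [leqRHS]big_mkcond leq_sum// => j _; case: (j \in T1).
  - by rewrite lee_fin heC.
rewrite -[leRHS]add0e !EFinD -!addeA.
have m1 := mU _ xpredT _ (fun ij : 'I_n * 'I_n => mI ij.1 ij.2).
have m2 := mU _ xpredT _ (fun ib : 'I_n * bool => mE tD (row_form ib.1 ib.2)).
have m3 := mU _ xpredT _ (fun ij : 'I_n * 'I_n => mE tL (entry_form ij.1 ij.2)).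
have m4 := mU _ (fun TS : {set 'I_n} * {set 'I_n} => C <= #|TS.1|%:R * m) _
  (fun TS => mE (delta * N * #|TS.1|%:R) (cut_form TS.1 TS.2)).
have m34 := measurableU _ _ m3 m4; have m234 := measurableU _ _ m2 m34.
apply: le_trans (measureU2 _ m1 m234) _; apply: leeD => //.
apply: le_trans (measureU2 _ m2 m34) _; apply: leeD => //.
by apply: le_trans (measureU2 _ m3 m4) _; exact: leeD.
Qed.

End probability.

Section good.
Variable M : 'M[R]_n.
Hypotheses (m0 : 0 <= m) (tL0 : 0 <= tL).
Hypothesis good : ~ bad_matrix M.

Let notin_big (I : finType) (D : pred I) (S : I -> set (rmatrix R n)) i :
  ~ (\big[setU/set0]_(i | D i) S i) M -> D i -> ~ S i M.
Proof. by move=> h Di Si; apply: h; rewrite (bigD1 i)//=; left. Qed.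

Let well_formed i j : ~ ill_formed i j M.
Proof.
have h : ~ (\big[setU/set0]_(ij : 'I_n * 'I_n) ill_formed ij.1 ij.2) M.
  by move=> h; apply: good; left.
exact: (notin_big (i := (i, j)) h).
Qed.

Let no_exceed t g : ~ exceeds t g M -> linear_form m g M < t.
Proof. by rewrite /exceeds /= => /negP; rewrite -ltNge. Qed.

Lemma good_symmetric : M^T = M.
Proof.
apply/matrixP => i j; rewrite mxE; apply/eqP; rewrite -subr_eq0; apply/negPn/negP => h.
by apply: (@well_formed j i); left.
Qed.

Lemma good_diagonal i : M i i = 0.
Proof.
apply/eqP/negPn/negP => h; apply: (@well_formed i i); right; left; exact: h.
Qed.

Lemma good_nonneg i j : 0 <= M i j.
Proof.
rewrite leNgt; apply/negP => h; apply: (@well_formed i j); right; right; exact: h.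
Qed.

Lemma good_degree i : `|\sum_j M i j - N| <= tD.
Proof.
have rowE b : linear_form m (row_form i b) M = (-1) ^+ b * (\sum_j M i j - N).
  rewrite /linear_form (bigD1 i)//= [X in _ + X]big1 ?addr0; last first.
    by move=> j ji; rewrite big1// => k _; rewrite /row_form (negbTE ji) mulr0 mul0r.
  transitivity ((-1) ^+ b * \sum_k centred m M i k).
    by rewrite mulr_sumr; apply: eq_bigr => k _; rewrite /row_form eqxx mulr1.
  congr (_ * _); rewrite [LHS](bigD1 i)//= /centred eqxx add0r [in RHS](bigD1 i)//=.
  rewrite good_diagonal add0r.
  have -> : N = \sum_(k | k != i) m.
    by rewrite sumr_const cardC1 card_ord /N mulr_natl.
  by rewrite -sumrB; apply: eq_bigr => k; rewrite eq_sym => /negbTE ->.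
have h (b : bool) : (-1) ^+ b * (\sum_j M i j - N) < tD.
  rewrite -rowE; apply: no_exceed.
  have h : ~ (\big[setU/set0]_(ib : 'I_n * bool) exceeds tD (row_form ib.1 ib.2)) M.
    by move=> h; apply: good; right; left.
  exact: (notin_big (i := (i, b)) h).
have := h true; have := h false; rewrite /= expr0 expr1 mul1r mulN1r => h1 h2.
by rewrite ler_norml lerNl !ltW.
Qed.

Lemma good_entry i j : M i j <= m + tL.
Proof.
have [->|ij] := eqVneq i j; first by rewrite good_diagonal addr_ge0.
have h : ~ (\big[setU/set0]_(ij : 'I_n * 'I_n) exceeds tL (entry_form ij.1 ij.2)) M.
  by move=> h; apply: good; right; right; left.
have := no_exceed (notin_big (i := (i, j)) h isT).
rewrite /linear_form (bigD1 i)//= [X in _ + X]big1 ?addr0; last first.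
  by move=> k ki; rewrite big1// => l _; rewrite /entry_form (negbTE ki) mul0r.
rewrite (bigD1 j)//= big1 ?addr0; last first.
  by move=> k kj; rewrite /entry_form (negbTE kj) andbF mul0r.
by rewrite /entry_form !eqxx /= mul1r /centred (negbTE ij) ltrBlDl => /ltW.
Qed.

Lemma good_cut (S1 S2 : {set 'I_n}) : C <= #|S1|%:R * m ->
  \sum_k (if k \in S2 then 1 else -1) * \sum_(j in S1) centred m M j k
    <= delta * N * #|S1|%:R.
Proof.
move=> CS.
have h : ~ (\big[setU/set0]_(TS : {set 'I_n} * {set 'I_n} | C <= #|TS.1|%:R * m)
     exceeds (delta * N * #|TS.1|%:R) (cut_form TS.1 TS.2)) M.
  by move=> h; apply: good; right; right; right.
have /ltW := no_exceed (notin_big (i := (S1, S2)) h CS); congr (_ <= _).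
rewrite /linear_form exchange_big/=; apply: eq_bigr => k _.
rewrite mulr_sumr [RHS]big_mkcond/=; apply: eq_bigr => j _.
by rewrite /cut_form; case: (j \in S1); rewrite ?mul1r ?mul0r.
Qed.

End good.
End bad_matrix.

(** * Maximizers outside the exceptional set *)

Section good_matrix_flat.
Context {R : realType}.

Lemma argmax_lnorm_scale n (r p : R) (a : R) (A : 'M[R]_n) v : 0 < p -> 0 < a ->
  argmax_lnorm r p A v -> argmax_lnorm r p (a *: A) v.
Proof.
move=> p0 a0 [v1 vmax].
have lZ y : lnorm p (a *: A *m y) = a * lnorm p (A *m y).
  have -> : a *: A *m y = a *: (A *m y) by rewrite scalemxAl.
  exact: (lnormZ (A *m y) p0 (ltW a0)).
split; first exact: v1.
by move=> x x1; rewrite (lZ x) (lZ v) ler_wpM2l ?(ltW a0) ?vmax.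
Qed.

Lemma good_matrix_flat (p r : R) : 1 < p -> p <= r ->
  exists eps0 delta0 : R, [/\ 0 < eps0, 0 < delta0 &
  forall n (M : 'M[R]_n) (m tD tL delta C : R), (1 < n)%N -> 0 < m ->
    0 <= tD -> 0 <= tL -> 0 <= delta -> 0 < C ->
    tD <= eps0 * (n.-1%:R * m) -> tD <= n.-1%:R * m ->
    2 * delta + 6 * C * (m + tL) / (m * (n.-1%:R * m)) + 4 / n.-1%:R <= delta0 ->
    ~ bad_matrix m tD tL delta C M ->
    forall v : 'cV[R]_n, argmax_lnorm r p M v -> nonneg_vec v ->
    forall i, `|v i 0 - n%:R `^ (- r^-1)| <=
      11 / 5 * p / (r - 1) * (tD / (n.-1%:R * m)) * n%:R `^ (- r^-1)].
Proof.
move=> p1 pr; have [eps0 [delta0 [eps00 delta00 flat]]] := argmax_flat p1 pr.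
have p0 : 0 < p by exact: lt_trans p1.
exists eps0, delta0; split => //.
move=> n M m tD tL delta C n1 m0 tD0 tL0 d0 C0 eD eN emix good v vmax v0.
have n10 : 0 < n.-1%:R :> R by rewrite ltr0n; case: (n) n1 => [|[]].
set N := n.-1%:R * m in eD eN emix *.
have N0 : 0 < N by rewrite mulr_gt0.
have nn := good_nonneg good.
have deg := good_degree good; rewrite -/N in deg.
have row i : \sum_j M i j <= 2 * N.
  by have := ler_norm (\sum_j M i j - N); have := deg i; lra.
have cut := good_cut good.
have mix := row_mixing_of_cut n1 m0 C0 (erefl N) d0 nn
  (good_entry (ltW m0) tL0 good) (good_diagonal good) row cut.
apply: (flat n (N^-1 *: M) v).
- exact: ltnW.
- by rewrite divr_ge0 ?(ltW N0)//= ler_pdivrMr.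
- by move=> i j; rewrite mxE mulr_ge0// invr_ge0 ltW.
- by rewrite linearZ/= (good_symmetric good).
- move=> i.
  have -> : \sum_j (N^-1 *: M) i j = 1 + (\sum_j M i j - N) / N.
    rewrite mulrBl divff ?gt_eqF// addrC subrK mulr_suml.
    by apply: eq_bigr => j _; rewrite mxE mulrC.
  have : `|(\sum_j M i j - N) / N| <= tD / N.
    by rewrite normrM (gtr0_norm (_ : 0 < N^-1)) ?invr_gt0// ler_pM2r ?invr_gt0.
  by rewrite ler_norml => /andP[h1 h2]; apply/andP; split; lra.
- move=> x K xK i; apply: (le_trans (mix x K xK i)).
  by rewrite ler_wpM2r//; apply: le_trans (xK i).
- by apply: argmax_lnorm_scale => //; rewrite invr_gt0.
- exact: v0.
Qed.
End good_matrix_flat.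

(** * Almost sure events *)

Section borel_cantelli.
Context d (T : measurableType d) (R : realType) (P : probability T R).

(** The series [4 / n^2] is compared with the telescoping series
    [4 / (n (n - 1))]; as only marginal probabilities enter, the joint law of the
    events is arbitrary. *)
Lemma eventually_as_inv_square (E F : nat -> set T) (n0 : nat) :
    (forall n, measurable (F n)) ->
    (forall n, (n0 <= n)%N -> (P (F n) <= (4 / n%:R ^+ 2)%:E)%E) ->
    (forall n, (n0 <= n)%N -> ~` F n `<=` E n) ->
  eventually_as P E.
Proof.
move=> mF PF FE.
pose G n := if (maxn n0 2 <= n)%N then F n else set0.
have mG n : measurable (G n) by rewrite /G; case: ifP.
have Gsum n : (\sum_(0 <= k < n.+2) P (G k) <= (4 - 4 / n.+1%:R)%:E)%E.
  elim: n => [|n IH].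
    by rewrite divr1 subrr 2?big_nat_recr// big_geq//= /G !geq_max !andbF measure0 !adde0.
  rewrite big_nat_recr//=; apply: (@le_trans _ _ ((4 - 4 / n.+1%:R)%:E + (4 / n.+2%:R ^+ 2)%:E)%E).
    apply: leeD => //; rewrite /G; case: ifPn => [|_].
      by rewrite geq_max => /andP[h _]; exact: PF.
    by rewrite measure0 lee_fin divr_ge0 ?exprn_ge0.
  rewrite -EFinD lee_fin.
  have a0 : 0 < n.+1%:R :> R by rewrite ltr0n.
  rewrite -[n.+2]addn1 natrD; move: (n.+1%:R : R) a0 => a a0.
  have a10 : 0 < a + 1 by rewrite addr_gt0.
  rewrite -addrA lerD2l -subr_ge0.
  have -> : - (4 / (a + 1)) - (- (4 / a) + 4 / (a + 1) ^+ 2) = 4 / (a * (a + 1) ^+ 2).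
    by field; rewrite !gt_eqF.
  by rewrite divr_ge0// mulr_ge0 ?exprn_ge0// ltW.
have Gfin : (\sum_(n <oo) P (G n) < +oo)%E.
  apply: (@le_lt_trans _ _ 4%:E); last exact: ltry.
  apply: lime_le; first exact: is_cvg_nneseries.
  exists 2%N => // n /= n2; case: n n2 => [|[|n]]// _.
  by apply: le_trans (Gsum n) _; rewrite lee_fin lerBlDr lerDl divr_ge0.
have G0 := lim_sup_set_cvg0 mG Gfin.
exists (lim_sup_set G); split => //.
  apply: bigcap_measurable; first by exists 0%N.
  by move=> k _; exact: bigcup_measurable.
move=> w /= hw k _.
apply: contrapT => hk; apply: hw.
exists (maxn k (maxn n0 2)) => // n /=; rewrite geq_max => /andP[kn n0n].
apply: FE; first by move: n0n; rewrite geq_max => /andP[].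
by move=> Fn; apply: hk; exists n => //; rewrite /G n0n.
Qed.

Lemma measurable_rmatrix_proj n :
  measurable_fun [set: rmatrix_seq R] (fun w : rmatrix_seq R => w n : rmatrix R n).
Proof.
apply: (@measurability _ _ (rmatrix_seq R) (rmatrix R n) setT
  (fun w : rmatrix_seq R => w n : rmatrix R n) (@entry_cylinders R n)) => //.
move=> _ [_ [i [j [B [mB ->]]]] <-].
by rewrite setTI; apply: sub_sigma_algebra; exists n, i, j, B; split.
Qed.
End borel_cantelli.

(** * Asymptotics of the parameters *)

Section growth.
Context {R : realType}.

Lemma near_le_powR (a K : R) : 0 < a -> \forall n \near \oo, K <= n%:R `^ a.
Proof.
move=> a0.
have K0 : 0 <= Num.max K 0 by rewrite le_max lexx orbT.
near=> n; apply: (@le_trans _ _ (Num.max K 0)); first by rewrite le_max lexx.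
have -> : Num.max K 0 = (Num.max K 0 `^ a^-1) `^ a.
  by rewrite -powRrM mulVf ?gt_eqF// powRr1.
rewrite ge0_ler_powR ?nnegrE ?powR_ge0 ?(ltW a0)//.
by near: n; exact: nbhs_infty_ger.
Unshelve. all: by end_near. Qed.

Lemma near_ln_ge1 : \forall n \near \oo, (1 : R) <= ln n%:R.
Proof.
near=> n.
have e1 : expR 1 <= n%:R :> R by near: n; exact: nbhs_infty_ger.
by rewrite -[leLHS](expRK 1) ler_ln ?posrE ?expR_gt0// (lt_le_trans (expR_gt0 1)).
Unshelve. all: by end_near. Qed.

(** The lower bound on [mu] makes [n mu^2] at least [n^(1/3) log n], and that on
    [sigma] makes [n sigma^2] at least a power of [n]. *)
Lemma parameter_growth_bounds (mu sigma : nat -> R) : parameter_growth mu sigma ->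
  exists K L : R, [/\ 0 < K, 0 < L,
    (\forall n \near \oo, mu n <= K /\ sigma n ^+ 2 <= L * mu n) &
    forall e, 0 < e -> \forall n \near \oo,
      [/\ 0 < mu n /\ 0 < sigma n, ln n%:R <= e * (n%:R * mu n ^+ 2),
          ln n%:R <= e * (n%:R * sigma n ^+ 2), (1 : R) <= ln n%:R & 1 <= e * n%:R]].
Proof.
move=> [/eqOP bmu gmu [c0 c00 gsigma] /eqOP bsig].
have ln1 := near_ln_ge1.
have mu_large : \forall n \near \oo, ln n%:R `^ (2 / 3) / n%:R `^ 3^-1 <= mu n.
  have /cvgryPge/(_ 1) g1 := gmu.
  near=> n.
  have n0 : 0 < n%:R :> R by rewrite ltr0n; near: n; exact: nbhs_infty_gt.
  have l0 : 0 < ln n%:R :> R by apply: (lt_le_trans ltr01); near: n.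
  have q0 : 0 < ln n%:R `^ (2 / 3) / n%:R `^ 3^-1 :> R by rewrite divr_gt0 ?powR_gt0.
  by rewrite -[leLHS]mul1r -ler_pdivlMr//; near: n.
have mu_pos : \forall n \near \oo, 0 < mu n.
  near=> n.
  have n0 : 0 < n%:R :> R by rewrite ltr0n; near: n; exact: nbhs_infty_gt.
  have l0 : 0 < ln n%:R :> R by apply: (lt_le_trans ltr01); near: n.
  apply: (@lt_le_trans _ _ (ln n%:R `^ (2 / 3) / n%:R `^ 3^-1)).
    by rewrite divr_gt0 ?powR_gt0.
  by near: n.
have [K [K0 hK]] : exists K : R, 0 < K /\ \forall n \near \oo, `|mu n| <= K * `|1 : R|.
  exact: (filter_ex (filterI (nbhs_pinfty_gt (num_real 0)) bmu)).
have [L [L0 hL]] : exists L : R, 0 < L /\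
    \forall n \near \oo, `|sigma n ^+ 2 / mu n| <= L * `|1 : R|.
  exact: (filter_ex (filterI (nbhs_pinfty_gt (num_real 0)) bsig)).
exists K, L; split => //.
  near=> n; split.
    have : `|mu n| <= K * `|1 : R| by near: n.
    by rewrite normr1 mulr1; apply: le_trans; exact: ler_norm.
  have mn0 : 0 < mu n by near: n.
  have : `|sigma n ^+ 2 / mu n| <= L * `|1 : R| by near: n.
  rewrite normr1 mulr1 -ler_pdivrMr//; apply: le_trans; exact: ler_norm.
move=> e e0; near=> n.
have n0 : 0 < n%:R :> R by rewrite ltr0n; near: n; exact: nbhs_infty_gt.
have l1 : 1 <= ln n%:R :> R by near: n.
have l0 : 0 < ln n%:R :> R by exact: lt_le_trans l1.
have mn0 : 0 < mu n by near: n.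
have sn : n%:R `^ (- 2^-1 + c0) <= sigma n by apply: gsigma; rewrite -(ltr0n R).
have sn0 : 0 < sigma n by apply: lt_le_trans sn; exact: powR_gt0.
split => //.
- have q0 : 0 <= ln n%:R `^ (2 / 3) / n%:R `^ 3^-1 :> R by rewrite divr_ge0 ?powR_ge0.
  have hm : ln n%:R `^ (2 / 3) / n%:R `^ 3^-1 <= mu n by near: n.
  have m2 : (ln n%:R `^ (2 / 3) / n%:R `^ 3^-1) ^+ 2 <= mu n ^+ 2.
    by rewrite lerXn2r ?nnegrE// ltW.
  have x1 : e^-1 <= n%:R `^ 3^-1 by near: n; apply: near_le_powR; rewrite invr_gt0.
  have nE : n%:R = (n%:R `^ 3^-1) ^+ 3 :> R.
    by rewrite -powR_mulrn ?powR_ge0// -powRrM mulVf ?pnatr_eq0// powRr1// ltW.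
  have lE : ln n%:R <= (ln n%:R `^ (2 / 3)) ^+ 2 :> R.
    rewrite -powR_mulrn ?powR_ge0// -powRrM -[leLHS](powRr1 (ltW l0)).
    by rewrite ler_powR//; lra.
  rewrite -ler_pdivrMl//.
  apply: (@le_trans _ _ (n%:R * (ln n%:R `^ (2 / 3) / n%:R `^ 3^-1) ^+ 2)); last first.
    by rewrite ler_pM2l.
  rewrite [in leRHS]expr_div_n [in X in X * (_ / _)]nE.
  have x0 : 0 < n%:R `^ 3^-1 :> R by exact: powR_gt0.
  move: (n%:R `^ 3^-1) x0 x1 => x x0 x1.
  have -> : x ^+ 3 * ((ln n%:R `^ (2 / 3)) ^+ 2 / x ^+ 2) = x * (ln n%:R `^ (2 / 3)) ^+ 2.
    by field; rewrite gt_eqF.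
  by apply: ler_pM => //; rewrite ?invr_ge0 ltW.
- have s2 : n%:R `^ (- 2^-1 + c0) ^+ 2 <= sigma n ^+ 2.
    by rewrite lerXn2r ?nnegrE ?powR_ge0// ltW.
  rewrite -ler_pdivrMl//.
  apply: (@le_trans _ _ (n%:R * n%:R `^ (- 2^-1 + c0) ^+ 2)); last by rewrite ler_pM2l.
  have -> : n%:R * n%:R `^ (- 2^-1 + c0) ^+ 2 = n%:R `^ c0 * n%:R `^ c0 :> R.
    rewrite -powR_mulrn ?powR_ge0// -powRrM -{1}(powRr1 (ltW n0)).
    rewrite -!powRD ?(gt_eqF n0) ?implybT//; congr (_ `^ _); lra.
  have x1 : e^-1 / c0 <= n%:R `^ c0 by near: n; exact: near_le_powR.
  have lnx : ln n%:R <= c0^-1 * n%:R `^ c0 :> R.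
    rewrite -ler_pdivrMl ?invr_gt0// invrK -ln_powR ltW// ln_sublinear//.
    exact: powR_gt0.
  apply: (@le_trans _ _ (e^-1 * (c0^-1 * n%:R `^ c0))).
    by rewrite ler_pM2l// invr_gt0.
  by rewrite mulrA ler_wpM2r// powR_ge0.
- by rewrite -ler_pdivrMl// mulr1; near: n; exact: nbhs_infty_ger.
Unshelve. all: by end_near. Qed.

End growth.

(** * Probability of the exceptional set *)

Section bad_matrix_rate.
Context {R : realType}.

Lemma exp_natmul_ln (k n : nat) : (0 < n)%N ->
  expR (- (k%:R * ln n%:R)) = (n%:R ^+ k)^-1 :> R.
Proof. by move=> n0; rewrite expRN expRM_natl lnK// posrE ltr0n. Qed.

Lemma four_exp_le_inv_square n : (4 <= n)%N ->
  4 ^+ n * expR (- (4 * n.-1%:R)) <= (n%:R ^+ 2)^-1 :> R.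
Proof.
move=> n4; have n0 : (0 < n)%N by exact: leq_trans n4.
have nE : n.-1%:R = n%:R - 1 :> R.
  by rewrite -[in RHS](prednK n0) -natr1 addrK.
have n4R : 4 <= n%:R :> R by rewrite (ler_nat R 4).
have e2 : 2 <= expR 1 :> R by have := expR_ge1Dx (1 : R); lra.
have h1 : 4 ^+ n <= expR (2 * n%:R) :> R.
  rewrite -natrM -[X in expR X]mulr1 expRM_natl.
  have -> : 4 ^+ n = 2 ^+ (2 * n) :> R by rewrite exprM; congr (_ ^+ _); rewrite expr2; lra.
  by rewrite lerXn2r ?nnegrE// ltW// expR_gt0.
have h2 : n%:R ^+ 2 <= expR (2 * (n%:R - 2)) :> R.
  have h3 : n%:R <= expR (n%:R - 2) :> R.
    have -> : n%:R - 2 = (n%:R - 2) / 2 + (n%:R - 2) / 2 :> R by lra.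
    rewrite expRD; have := expR_ge1Dx ((n%:R - 2) / 2 : R).
    have -> : 1 + (n%:R - 2) / 2 = n%:R / 2 :> R by lra.
    move=> h; apply: (@le_trans _ _ (n%:R / 2 * (n%:R / 2))).
      by move: n4R; clear; nra.
    by apply: ler_pM => //; rewrite divr_ge0.
  by rewrite expRM_natl lerXn2r ?nnegrE// ltW// expR_gt0.
apply: (@le_trans _ _ (expR (2 * n%:R) * expR (- (4 * n.-1%:R)))).
  by rewrite ler_wpM2r// expR_ge0.
rewrite -expRD nE.
have -> : 2 * n%:R - 4 * (n%:R - 1) = - (2 * (n%:R - 2)) :> R by ring.
by rewrite expRN lef_pV2 ?posrE ?expR_gt0// exprn_gt0// (lt_le_trans _ n4R).
Qed.

(** A row sum has variance about [n s^2]; 13/5 standard deviations times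
    [sqrt (log n)] leave a probability of at most [n^(-3)] in each direction. *)
Definition degree_radius n (s : R) : R := 13 / 5 * s * Num.sqrt (n%:R * ln n%:R).

(** The solution [t] of [l t - 53/50 l^2 s^2 = 4 log n], so that a single entry
    exceeds its mean by [t] with probability at most [n^(-4)]. *)
Definition entry_radius n (s l : R) : R :=
  (4 * ln n%:R + 53 / 50 * l ^+ 2 * s ^+ 2) / l.

(** The threshold [8 / (lC delta)] for the size of the sets makes each cut event
    of probability at most [exp (- 4 (n - 1))], which outweighs the [4^n] cuts. *)
Lemma bad_matrix_prob_le d (T : measurableType d) (P : probability T R) n
    (A : {RV P >-> rmatrix R n}) (F : probability R R)
    (m s c delta L lC lL e : R) :
    (4 <= n)%N -> 0 < m -> 0 < s -> 0 < c -> 0 < delta -> 0 < lC -> 0 < lL -> 0 < e ->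
    symmetric_iid_entries P A F -> bernstein_law F m (s ^+ 2) c -> nonneg_dist F ->
    s ^+ 2 <= L * m ->
    lC * 2 * c <= 20^-1 -> lL * 2 * c <= 20^-1 -> 53 / 25 * lC * L <= delta ->
    ln n%:R <= e ^+ 2 * (n%:R * s ^+ 2) -> 26 / 5 * e * c <= 20^-1 ->
  (distribution P A (bad_matrix m (degree_radius n s) (entry_radius n s lL)
      delta (8 / (lC * delta))) <=
    (4 / n%:R ^+ 2)%:E)%E.
Proof.
move=> n4 m0 s0 c0 delta0 lC0 lL0 e0 hA hF F0 sL lCc lLc lCL lnn ec.
set tD := degree_radius n s; set tL := entry_radius n s lL.
have n0 : (0 < n)%N by exact: leq_trans n4.
have nR : 0 < n%:R :> R by rewrite ltr0n.
have n1R : 0 <= n.-1%:R :> R by [].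
have ln0 : 0 <= ln n%:R :> R by rewrite ln_ge0// ler1n.
have ns0 : 0 < n%:R * s ^+ 2 by rewrite mulr_gt0 ?exprn_gt0.
have tD0 : 0 <= tD by rewrite /tD /degree_radius !mulr_ge0 ?sqrtr_ge0// ltW.
have tD2 : tD ^+ 2 = 169 / 25 * ln n%:R * (n%:R * s ^+ 2).
  by rewrite /tD /degree_radius !exprMn sqr_sqrtr ?mulr_ge0//; field.
(* The minimizer of the Gaussian exponent [- l tD + l^2 n s^2 / 2]. *)
pose lD := tD / (n%:R * s ^+ 2).
have lD0 : 0 <= lD by rewrite divr_ge0// ltW.
have lDe : lD <= 13 / 5 * e.
  have e1 : 0 <= 13 / 5 * e by rewrite mulr_ge0// ltW.
  rewrite -(@ler_pXn2r _ 2) ?nnegrE// expr_div_n tD2.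
  rewrite ler_pdivrMr ?exprn_gt0//.
  have := ler_wpM2r (ltW ns0) lnn; rewrite exprMn; move: (_ * s ^+ 2) => x; nra.
have := @bad_matrix_prob R n m tD tL delta (8 / (lC * delta)) d T P A F (s ^+ 2) c
  hA hF F0 (sqr_ge0 s) (ltW c0) lD lL lC (expR (- (4 * n.-1%:R)))
  lD0 (ltW lL0) (ltW lC0) _ lLc lCc (expR_ge0 _) _.
have lDc : lD * 2 * c <= 20^-1.
  by apply: le_trans ec; rewrite ler_wpM2r ?(ltW c0)//; move: lDe; clear; lra.
move=> /(_ lDc) H; apply: le_trans (H _) _.
  move=> k hk; rewrite ler_expR.
  have lCd : 0 < lC * delta by rewrite mulr_gt0.
  have hk2 : 8 <= k%:R * m * (lC * delta) by rewrite -ler_pdivrMr.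
  have h1 : lC * s ^+ 2 * (53 / 25) <= delta * m.
    apply: (@le_trans _ _ (53 / 25 * lC * L * m)); last by rewrite ler_wpM2r// ltW.
    by have := ler_wpM2l (ltW lC0) sL; clear; lra.
  have h2 : n.-1%:R * k%:R * lC * (lC * s ^+ 2 * (53 / 25)) <=
            n.-1%:R * k%:R * lC * (delta * m).
    by rewrite ler_wpM2l// !mulr_ge0// ltW.
  have h3 := ler_wpM2l n1R hk2.
  by move: h2 h3; clear; lra.
rewrite lee_fin.
have E1 : n%:R * expR (- (lD * tD) + 53 / 100 * lD ^+ 2 * s ^+ 2 * n.-1%:R) <=
    (n%:R ^+ 2)^-1 :> R.
  have -> : (n%:R ^+ 2)^-1 = n%:R * expR (- (3%:R * ln n%:R)) :> R.
    by rewrite exp_natmul_ln// !exprS expr0; field; rewrite gt_eqF.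
  rewrite ler_pM2l// ler_expR.
  have lDtD : lD * tD = 169 / 25 * ln n%:R.
    by rewrite /lD mulrAC -expr2 tD2 mulfK// gt_eqF.
  have lDs : lD ^+ 2 * s ^+ 2 * n.-1%:R <= 169 / 25 * ln n%:R.
    have -> : lD ^+ 2 * s ^+ 2 = 169 / 25 * ln n%:R / n%:R.
      by rewrite /lD expr_div_n tD2; field; rewrite !gt_eqF.
    rewrite mulrAC ler_pdivrMr// ler_wpM2l ?mulr_ge0// ler_nat.
    exact: leq_pred.
  by rewrite lDtD; move: lDs ln0; clear; lra.
have E2 : n%:R ^+ 2 * expR (- (lL * tL) + 53 / 100 * lL ^+ 2 * s ^+ 2 * 2) =
    (n%:R ^+ 2)^-1 :> R.
  have -> : - (lL * tL) + 53 / 100 * lL ^+ 2 * s ^+ 2 * 2 = - (4%:R * ln n%:R).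
    by rewrite /tL /entry_radius; field; rewrite gt_eqF.
  by rewrite exp_natmul_ln//; field; rewrite gt_eqF.
have E3 := four_exp_le_inv_square n4.
by rewrite E2; move: E1 E3; clear; lra.
Qed.

End bad_matrix_rate.

(** * Conclusion *)

Section final_bound.
Context {R : realType}.

Lemma natr_le_double_pred n : (1 < n)%N -> n%:R <= 2 * n.-1%:R :> R.
Proof.
by rewrite -natrM ler_nat; case: n => [|[|n]]// _; rewrite mulnS/= addSn ltnS leq_addr.
Qed.

Lemma degree_radius_le n (m s e S : R) : (1 < n)%N -> 0 < m -> 0 < e -> 0 < s ->
    s <= S -> ln n%:R <= e ^+ 2 * (n%:R * m ^+ 2) ->
  degree_radius n s <= 26 / 5 * S * e * (n.-1%:R * m).
Proof.
move=> n1 m0 e0 s0 sS lnn.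
have n0 : 0 < n%:R :> R by rewrite ltr0n (ltn_trans _ n1).
have ln0 : 0 <= ln n%:R :> R by rewrite ln_ge0// ler1n (ltn_trans _ n1).
have n2 := natr_le_double_pred n1.
have enm0 : 0 <= e * (n%:R * m) by rewrite !mulr_ge0// ltW.
have sq : Num.sqrt (n%:R * ln n%:R) <= e * (n%:R * m).
  rewrite -[leRHS](ger0_norm enm0) -sqrtr_sqr ler_sqrt ?sqr_ge0//.
  have := ler_wpM2l (ltW n0) lnn; congr (_ <= _); ring.
have S0 : 0 < S by exact: lt_le_trans sS.
apply: (@le_trans _ _ (13 / 5 * S * (e * (n%:R * m)))).
  by apply: ler_pM; rewrite ?sqrtr_ge0 ?mulr_ge0 ?(ltW s0)// ler_wpM2l.
have P0 : 0 <= 13 / 5 * S * e * m by rewrite !mulr_ge0// ltW.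
by have := ler_wpM2l P0 n2; clear; lra.
Qed.

(** The product 11/5 * 13/5 is 5.72; the slack up to 6 absorbs the factor
    [n / (n - 1)]. *)
Lemma degree_radius_rate n (m s : R) : (25 <= n)%N -> 0 < m -> 0 < s ->
  11 / 5 * (degree_radius n s / (n.-1%:R * m)) <=
    6 * Num.sqrt (ln n%:R / (n%:R * m) * (s ^+ 2 / m)).
Proof.
move=> n25 m0 s0; have n0' : (0 < n)%N by exact: leq_trans n25.
have n0 : 0 < n%:R :> R by rewrite ltr0n.
have ln0 : 0 <= ln n%:R :> R by rewrite ln_ge0// ler1n.
have nE : n%:R = n.-1%:R + 1 :> R by rewrite natr1 prednK.
have n24 : 24 <= n.-1%:R :> R by rewrite (ler_nat R 24) -ltnS prednK.
have -> : ln n%:R / (n%:R * m) * (s ^+ 2 / m) = (n%:R * ln n%:R) * (s / (n%:R * m)) ^+ 2.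
  by field; rewrite !gt_eqF.
have snm : 0 <= s / (n%:R * m) by rewrite divr_ge0 ?mulr_ge0// ltW.
rewrite sqrtrM ?mulr_ge0// sqrtr_sqr (ger0_norm snm) /degree_radius.
have := sqrtr_ge0 (n%:R * ln n%:R : R); move: (Num.sqrt _) => q q0.
have p0 : 0 < n.-1%:R :> R by apply: lt_le_trans n24.
have k0 : 0 <= s * q / (n.-1%:R * n%:R * m).
  by rewrite divr_ge0 ?mulr_ge0// ltW.
rewrite -subr_ge0.
have -> : 6 * (q * (s / (n%:R * m))) - 11 / 5 * (13 / 5 * s * q / (n.-1%:R * m)) =
    (6 * n.-1%:R - 143 / 25 * n%:R) * (s * q / (n.-1%:R * n%:R * m)).
  by field; rewrite !gt_eqF.
by rewrite mulr_ge0// nE; move: n24; clear; lra.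
Qed.

(** The share of the exceptional indices in a row is of order
    [log n / (n m^2)]. *)
Lemma entry_error_le n (m C K K1 L s l e : R) : (1 < n)%N -> 0 < m -> 0 < C -> 0 < l ->
    0 < K -> 0 < L -> m <= K -> s ^+ 2 <= L * m -> (1 : R) <= ln n%:R ->
    K1 = K + 4 / l + 53 / 50 * l * (L * K) ->
    ln n%:R <= e * (n%:R * m ^+ 2) ->
  6 * C * (m + entry_radius n s l) / (m * (n.-1%:R * m)) <= 12 * C * K1 * e.
Proof.
move=> n1 m0 C0 l0 K0 L0 mK sL ln1 K1E lnn.
have n10 : 0 < n.-1%:R :> R by rewrite ltr0n; case: (n) n1 => [|[]].
have n2 := natr_le_double_pred n1.
have K10 : 0 < K1 by rewrite K1E !addr_gt0 ?divr_gt0 ?mulr_gt0.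
have h1 : m + entry_radius n s l <= K1 * ln n%:R.
  have -> : entry_radius n s l = 4 / l * ln n%:R + 53 / 50 * l * s ^+ 2.
    by rewrite /entry_radius; field; rewrite gt_eqF.
  have sLK : s ^+ 2 <= L * K by apply: (le_trans sL); rewrite ler_pM2l.
  have h2 : 53 / 50 * l * s ^+ 2 <= 53 / 50 * l * (L * K) * ln n%:R.
    rewrite -[leRHS]mulrA ler_wpM2l ?mulr_ge0 ?(ltW l0)//.
    by apply: (le_trans sLK); rewrite ler_peMr// ltW// mulr_gt0.
  have h3 : m <= K * ln n%:R by apply: (le_trans mK); rewrite ler_peMr// ltW.
  by rewrite K1E; move: h2 h3; clear; lra.
rewrite ler_pdivrMr ?mulr_gt0//.
apply: (@le_trans _ _ (6 * C * (K1 * ln n%:R))).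
  by rewrite ler_wpM2l// mulr_ge0// ltW.
have e0 : 0 <= e.
  have nm : 0 < n%:R * m ^+ 2.
    by rewrite mulr_gt0 ?exprn_gt0// ltr0n (ltn_trans _ n1).
  by rewrite -(pmulr_lge0 _ nm) (le_trans _ lnn)// (le_trans _ ln1).
apply: (@le_trans _ _ (6 * C * (K1 * (e * (2 * n.-1%:R * m ^+ 2))))); last first.
  by rewrite le_eqVlt; apply/orP; left; apply/eqP; ring.
rewrite ler_wpM2l ?mulr_ge0 ?(ltW C0)// ler_wpM2l ?(ltW K10)// (le_trans lnn)//.
by rewrite ler_wpM2l// ler_wpM2r// sqr_ge0.
Qed.

End final_bound.

(** The common bound behind both parts. The constants [delta], [lC] and [lL] fix
    the exceptional set; the number [e] then measures how large [n] has to be. *)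
Lemma maximizer_nearly_constant (R : realType) (p r : R)
    (F : nat -> probability R R)
    (mu sigma : nat -> R)
    (d : nat -> measure_display) (T : forall n, measurableType (d n))
    (P : forall n, probability (T n) R)
    (A : forall n, {RV (P n) >-> rmatrix R n})
    (P0 : probability (rmatrix_seq R) R)
    (hF_supp : forall n, (0 < n)%N -> nonneg_dist (F n))
    (hF_fin : forall n, (0 < n)%N -> finite_mean_var (F n))
    (hmu : forall n, mu n = dist_mean (F n))
    (hsigma : forall n, sigma n = dist_std (F n))
    (hi : forall n, (0 < n)%N -> symmetric_iid_entries (P n) (A n) (F n))
    (hii : parameter_growth mu sigma)
    (hiii : bernstein_moments P (fun n => A n) mu sigma)
    (hP0 : forall n, (0 < n)%N ->
       has_law P0 (fun w : rmatrix_seq R => w n : rmatrix R n)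
         (distribution (P n) (A n))) : 1 < p -> p <= r ->
  eventually_as P0 (fun n => [set w : rmatrix_seq R |
    forall v : 'cV[R]_n, argmax_lnorm r p (w n) v -> nonneg_vec v ->
      linf_norm (v - n%:R `^ (- r^-1) *: const_mx 1)
      <= 6 * p / (r - 1) * n%:R `^ (- r^-1)
         * Num.sqrt (ln n%:R / (n%:R * mu n) * (sigma n ^+ 2 / mu n))]).
Proof.
move=> p1 pr.
have [eps0 [delta0 [eps00 delta00 flat]]] := good_matrix_flat p1 pr.
have [K [L [K0 L0 bounds small]]] := parameter_growth_bounds hii.
have [cb hcb] := hiii.
pose c := `|cb| + 1.
have c0 : 0 < c by rewrite ltr_wpDl.
pose delta := delta0 / 8.
have deltap : 0 < delta by rewrite divr_gt0.
pose lL := (40 * c)^-1.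
have lL0 : 0 < lL by rewrite invr_gt0 mulr_gt0.
pose lC := Num.min lL (delta / (53 / 25 * L)).
have lC0 : 0 < lC by rewrite lt_min lL0 divr_gt0// mulr_gt0.
pose C := 8 / (lC * delta).
have C0 : 0 < C by rewrite divr_gt0// mulr_gt0.
pose K1 := K + 4 / lL + 53 / 50 * lL * (L * K).
have K10 : 0 < K1 by rewrite !addr_gt0 ?divr_gt0 ?mulr_gt0.
pose S := L * K + 1.
have S0 : 0 < S by rewrite addr_gt0// mulr_gt0.
(* The bounds on [e] ensure, in this order: [e^2 <= e]; a Chernoff parameter for
   rows of at most [1 / (40 c)]; row sums within [eps0] of 1 after normalization;
   a mixing constant of at most [delta0]. *)
have [e [e0 e1 e2 e3 e4]] : exists e : R, [/\ 0 < e, e <= 25^-1, 26 / 5 * e * c <= 20^-1,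
    26 / 5 * S * e <= Num.min eps0 1 & 12 * C * K1 * e <= delta0 / 4 /\ 8 * e <= delta0 / 4].
  pose e := Num.min 25^-1 (Num.min (20^-1 / (26 / 5 * c))
    (Num.min (Num.min eps0 1 / (26 / 5 * S))
    (Num.min (delta0 / 4 / (12 * C * K1)) (delta0 / 4 / 8)))).
  exists e; rewrite /e; split.
  - have q1 : 0 < 20^-1 / (26 / 5 * c) by rewrite divr_gt0 ?mulr_gt0.
    have q2 : 0 < Num.min eps0 1 / (26 / 5 * S).
      by apply: divr_gt0; [rewrite lt_min eps00 ltr01|rewrite mulr_gt0].
    have q3 : 0 < delta0 / 4 / (12 * C * K1).
      by apply: divr_gt0; [exact: divr_gt0|rewrite mulr_gt0// mulr_gt0].
    have q4 : 0 < delta0 / 4 / 8 by rewrite divr_gt0// divr_gt0.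
    by rewrite !lt_min q1 q2 q3 q4 invr_gt0 ltr0n.
  - by rewrite ge_min lexx.
  - rewrite -[_ * _ * c]mulrA mulrCA.
    by rewrite -ler_pdivlMr ?mulr_gt0// !ge_min lexx ?orbT.
  - by rewrite mulrC -ler_pdivlMr ?mulr_gt0// !ge_min lexx ?orbT.
  - have CK0 : 0 < 12 * C * K1 by rewrite mulr_gt0// mulr_gt0.
    by split; rewrite mulrC -ler_pdivlMr// !ge_min lexx ?orbT.
have lLc : lL * 2 * c <= 20^-1.
  by rewrite le_eqVlt; apply/orP; left; apply/eqP; rewrite /lL; field; rewrite gt_eqF.
have lCc : lC * 2 * c <= 20^-1.
  by apply: le_trans lLc; rewrite !ler_wpM2r// ?(ltW c0)// ge_min lexx.
have lCL : 53 / 25 * lC * L <= delta.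
  by rewrite mulrAC mulrC -ler_pdivlMr ?mulr_gt0// ge_min lexx orbT.
have ee0 : 0 < e ^+ 2 by rewrite exprn_gt0.
have [n0 _ hn0] := filterI bounds (small _ ee0).
pose bad n := bad_matrix (mu n) (degree_radius n (sigma n)) (entry_radius n (sigma n) lL)
  delta C : set (rmatrix R n).
apply: (eventually_as_inv_square
  (F := fun n => (fun w : rmatrix_seq R => w n : rmatrix R n) @^-1` bad n)
  (n0 := maxn n0 25)).
- move=> n; rewrite -[X in measurable X]setTI.
  by apply: measurable_rmatrix_proj => //; exact: measurable_bad_matrix.
- move=> n; rewrite geq_max => /andP[/hn0[[muK sigL] [[mu0 sig0] lnm lns ln1 _]] n25].
  have n0' : (0 < n)%N by exact: leq_trans n25.
  have n1 : (1 < n)%N by exact: leq_trans n25.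
  rewrite (hP0 n n0'); last exact: measurable_bad_matrix.
  have blaw : bernstein_law (F n) (mu n) (sigma n ^+ 2) c.
    rewrite hmu hsigma; apply: bernstein_law_of_moments; first exact: hF_fin.
    move=> k k3; rewrite -hmu -hsigma.
    pose i : 'I_n := Ordinal n0'; pose j : 'I_n := Ordinal n1.
    have := hcb n i j k erefl erefl k3; rewrite unlock; apply: le_trans.
    have [_ _ lawA _] := hi n n0'.
    have mA : measurable_fun setT (fun w => (A n w : 'M[R]_n) i j).
      exact: (measurableT_comp (@measurable_entry R n i j)).
    rewrite (ge0_integral_has_law mA (lawA i j isT) (g := fun x => `|x - mu n| ^+ k))//.
    apply: measurable_funX; apply: measurableT_comp => //.
    by apply: measurable_funB => //; exact: measurable_cst.
  apply: (bad_matrix_prob_le (e := e) _ mu0 sig0 c0 deltap lC0 lL0 e0 (hi n n0') blaw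
    (hF_supp n n0') sigL lCc lLc lCL lns e2).
  exact: leq_trans n25.
- move=> n; rewrite geq_max => /andP[/hn0[[muK sigL] [[mu0 sig0] lnm lns ln1 en]] n25].
  have n0' : (0 < n)%N by exact: leq_trans n25.
  have n1 : (1 < n)%N by exact: leq_trans n25.
  have nR : 0 < n%:R :> R by rewrite ltr0n.
  have n1R : 0 < n.-1%:R :> R by rewrite ltr0n; case: (n) n1 => [|[]].
  have N0 : 0 < n.-1%:R * mu n by rewrite mulr_gt0.
  have lnn0 : 0 <= ln n%:R :> R by exact: le_trans ln1.
  have sigS : sigma n <= S.
    have sLK : sigma n ^+ 2 <= L * K by apply: (le_trans sigL); rewrite ler_pM2l.
    have LK0 : 0 < L * K by rewrite mulr_gt0.
    rewrite -(@ler_pXn2r _ 2) ?nnegrE ?(ltW sig0) ?(ltW S0)//; apply: (le_trans sLK).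
    by rewrite /S; move: LK0; move: (L * K) => x x0; nra.
  have tD0 : 0 <= degree_radius n (sigma n).
    by rewrite /degree_radius !mulr_ge0 ?sqrtr_ge0 ?(ltW sig0).
  have tL0 : 0 <= entry_radius n (sigma n) lL.
    have x0 : 0 <= lL ^+ 2 * sigma n ^+ 2 by apply: mulr_ge0; exact: sqr_ge0.
    rewrite /entry_radius divr_ge0 ?(ltW lL0)// -mulrA.
    by move: (lL ^+ 2 * _) (ln _) x0 lnn0; clear => *; lra.
  have tDN := degree_radius_le n1 mu0 e0 sig0 sigS lnm.
  have [tDe tD1] : degree_radius n (sigma n) <= eps0 * (n.-1%:R * mu n) /\
      degree_radius n (sigma n) <= n.-1%:R * mu n.
    split; apply: (le_trans tDN); last rewrite -[leRHS]mul1r; rewrite ler_wpM2r ?(ltW N0)//.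
      by apply: (le_trans e3); rewrite ge_min lexx.
    by apply: (le_trans e3); rewrite ge_min lexx orbT.
  have emix : 2 * delta + 6 * C * (mu n + entry_radius n (sigma n) lL) /
      (mu n * (n.-1%:R * mu n)) + 4 / n.-1%:R <= delta0.
    have h1 := entry_error_le n1 mu0 C0 lL0 K0 L0 muK sigL ln1 (erefl K1) lnm.
    have ee : e ^+ 2 <= e by rewrite expr2 ler_piMl ?(ltW e0)//; apply: (le_trans e1); rewrite invf_le1// ler1n.
    have h2 : 12 * C * K1 * e ^+ 2 <= 12 * C * K1 * e.
      by rewrite ler_wpM2l// ltW// mulr_gt0// mulr_gt0.
    have [e41 e42] := e4.
    have h3 : 4 / n.-1%:R <= 8 * e.
      rewrite ler_pdivrMr//.
      have n2 : n%:R <= 2 * n.-1%:R :> R by exact: natr_le_double_pred.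
      have h4 : 1 <= e * n%:R by apply: (le_trans en); rewrite ler_wpM2r.
      have h5 := ler_wpM2l (ltW e0) n2.
      by move: h4 h5; clear; lra.
    have := le_trans h1 (le_trans h2 e41); have := le_trans h3 e42.
    move: (4 / _) (6 * C * _ / _) => x y; rewrite /delta.
    by move: delta00; clear; lra.
  move=> w good v vmax v0.
  have bound := flat n (w n) _ _ _ _ _ n1 mu0 tD0 tL0 (ltW deltap) C0 tDe tD1 emix good v vmax v0.
  have rate := degree_radius_rate n25 mu0 sig0.
  have a0 : 0 <= n%:R `^ (- r^-1) :> R by exact: powR_ge0.
  have pr0 : 0 <= p / (r - 1).
    by rewrite divr_ge0 ?subr_ge0 ?(le_trans _ (ltW p1))// (le_trans (ltW p1)).
  have fin : forall i, `|(v - n%:R `^ (- r^-1) *: const_mx 1) i 0| <=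
      6 * p / (r - 1) * n%:R `^ (- r^-1)
         * Num.sqrt (ln n%:R / (n%:R * mu n) * (sigma n ^+ 2 / mu n)).
    move=> i; rewrite !mxE mulr1; apply: (le_trans (bound i)).
    have := ler_wpM2l (mulr_ge0 pr0 a0) rate; congr (_ <= _); ring.
  by apply: bigmax_le => [|i _]; [exact: le_trans (fin (Ordinal n0'))|exact: fin].
Qed.

Theorem theorem2p7 (R : realType)
    (F : nat -> probability R R)
    (mu sigma : nat -> R)
    (d : nat -> measure_display) (T : forall n, measurableType (d n))
    (P : forall n, probability (T n) R)
    (A : forall n, {RV (P n) >-> rmatrix R n})
    (P0 : probability (rmatrix_seq R) R)
    (hF_supp : forall n, (0 < n)%N -> nonneg_dist (F n))
    (hF_fin : forall n, (0 < n)%N -> finite_mean_var (F n))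
    (hmu : forall n, mu n = dist_mean (F n))
    (hsigma : forall n, sigma n = dist_std (F n))
    (hi : forall n, (0 < n)%N -> symmetric_iid_entries (P n) (A n) (F n))
    (hii : parameter_growth mu sigma)
    (hiii : bernstein_moments P (fun n => A n) mu sigma)
    (hP0 : forall n, (0 < n)%N ->
       has_law P0 (fun w : rmatrix_seq R => w n : rmatrix R n)
         (distribution (P n) (A n))) :
  (forall p r : R, 1 < p -> p < r ->
     eventually_as P0 (fun n => [set w : rmatrix_seq R |
       forall v : 'cV[R]_n, argmax_lnorm r p (w n) v -> nonneg_vec v ->
         linf_norm (v - n%:R `^ (- r^-1) *: const_mx 1)
         <= 6 * p / (r - p) * n%:R `^ (- r^-1)
            * Num.sqrt (ln n%:R / (n%:R * mu n) * (sigma n ^+ 2 / mu n))]))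
  /\
  (forall r : R, 1 < r ->
     eventually_as P0 (fun n => [set w : rmatrix_seq R |
       forall v : 'cV[R]_n, argmax_lnorm r r (w n) v -> nonneg_vec v ->
         linf_norm (v - n%:R `^ (- r^-1) *: const_mx 1)
         <= 60 * r / (r - 1) * n%:R `^ (- r^-1)
            * Num.sqrt (ln n%:R / (n%:R * mu n) * (sigma n ^+ 2 / mu n))])).
Proof.
have main p r := maximizer_nearly_constant (p := p) (r := r)
  hF_supp hF_fin hmu hsigma hi hii hiii hP0.
have weaken (p r : R) (k : R) : 1 < p -> p <= r -> 6 * p / (r - 1) <= k ->
    eventually_as P0 (fun n => [set w : rmatrix_seq R |
       forall v : 'cV[R]_n, argmax_lnorm r p (w n) v -> nonneg_vec v ->
         linf_norm (v - n%:R `^ (- r^-1) *: const_mx 1)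
         <= k * n%:R `^ (- r^-1)
            * Num.sqrt (ln n%:R / (n%:R * mu n) * (sigma n ^+ 2 / mu n))]).
  move=> p1 pr pk; have := main p r p1 pr; apply: filterS => w.
  apply: filterS => n h v vmax v0; apply: (le_trans (h v vmax v0)).
  by rewrite ler_wpM2r ?sqrtr_ge0// ler_wpM2r ?powR_ge0.
split=> [p r p1 pr|r r1]; apply: weaken => //; first exact: ltW.
- have p0 : 0 < p by exact: lt_trans p1.
  have r1 : 0 < r - 1 by rewrite subr_gt0 (lt_trans p1).
  rewrite ler_wpM2l ?mulr_ge0 ?(ltW p0)// lef_pV2 ?posrE ?subr_gt0//;
    last exact: lt_trans p1 pr.
  by rewrite lerD2l lerN2 ltW.
- have r0 : 0 < r by exact: lt_trans r1.
  have s0 : 0 < r - 1 by rewrite subr_gt0.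
  have rs0 : 0 <= r / (r - 1) by rewrite divr_ge0// ltW.
  by rewrite -!mulrA ler_wpM2r// ler_nat.
Qed.
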